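(* For all integers $d,s,u\ge1$ there exists $r(d,s,u)$ such that the following holds. Let $K/\mathbb Q_p$ be a finite extension of degree $u$, $\mathcal O\subset K$ its ring of integers, $\mathfrak p$ the maximal ideal, $q=|\mathcal O/\mathfrak p|$, and for $l\ge1$ let $A_l=\mathcal O/\mathfrak p^l$. Let $P:A_l^n\to A_l$ be a polynomial of degree $d$ (with coefficients in $A_l$) such that the reduction $\hat P:(\mathbb F_q^n)^d\to\mathbb F_q$ of $\tilde P$ modulo $\mathfrak p$ has rank $\ge r(d,s,u)$. Then $|b(P;\chi)|<q^{-s\,d(\chi)}$ for every nontrivial additive character $\chi\in\Xi_l$.
   Context: $\Xi_l$ is the group of additive characters $\chi:A_l\to\mathbb C^\star$; for $\chi\in\Xi_l$, $d(\chi)$ is the smallest $d'\ge0$ such that $\chi$ is trivial on $\mathfrak p^{d'}A_l$. $b(P;\chi):=q^{-nl}\sum_{v\in A_l^n}\chi(P(v))$. $\tilde P:(A_l^n)^d\to A_l$ is the multilinear form $\tilde P(h_1,\dots,h_d)=\Delta_{h_d}\cdots\Delta_{h_1}P$, where $\Delta_hP(x)=P(x+h)-P(x)$; $\hat P$ is its reduction mod $\mathfrak p$, a multilinear form on $(\mathbb F_q^n)^d$ with $\mathbb F_q=\mathcal O/\mathfrak p$. Rank means Schmidt rank over $\mathbb F_q$: minimal $r$ with $\hat P=\sum_{i=1}^rQ_iR_i$, $Q_i,R_i$ polynomials of degree $<d$. *)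

(* Defs.v *)
From HB Require Import structures.
From mathcomp Require Import all_boot all_order all_algebra all_field.
From mathcomp Require Import mpoly.
Set Implicit Arguments. Unset Strict Implicit. Unset Printing Implicit Defensive.
Import Order.TTheory GRing.Theory Num.Theory.
Local Open Scope ring_scope.

Definition rdvd (O : comNzRingType) (a b : O) : Prop := exists c, b = a * c.

Definition is_DVR (O : idomainType) (pi : O) : Prop :=
  [/\ pi != 0, pi \isn't a GRing.unit &
      forall x : O, x != 0 ->
        exists (k : nat) (w : O), w \is a GRing.unit /\ x = w * pi ^+ k].

Definition pi_complete (O : idomainType) (pi : O) : Prop :=
  forall x : nat -> O, (forall k, rdvd (pi ^+ k) (x k.+1 - x k)) ->
    exists y : O, forall k, rdvd (pi ^+ k) (y - x k).

Definition char0 (O : idomainType) : Prop := forall m : nat, m.+1%:R != 0 :> O.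

Definition add_char (A : finComNzRingType) (chi : A -> algC) : Prop :=
  (forall x y, chi (x + y) = chi x * chi y) /\ (forall x, chi x != 0).

(* chi is trivial on a^k A  (with a the image of the uniformizer, so a^k A = p^k A_l) *)
Definition trivial_on (A : finComNzRingType) (chi : A -> algC) (a : A) (k : nat) : bool :=
  [forall x : A, chi (a ^+ k * x) == 1].

(* d(chi): smallest d' >= 0 such that chi is trivial on p^{d'} A_l
   (searched in 0..#|A|, which contains l since #|A| = q^l > l). *)
Definition dchi (A : finComNzRingType) (chi : A -> algC) (a : A) : nat :=
  find (trivial_on chi a) (iota 0 #|A|.+1).

Definition bsum (A : finComNzRingType) (n : nat) (q l : nat) (P : {mpoly A[n]})
    (chi : A -> algC) : algC :=
  ((q%:R ^+ (n * l))^-1) * \sum_(v : {ffun 'I_n -> A}) chi (P.@[v]).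

Definition diffop (A : finComNzRingType) (n : nat) (h : 'I_n -> A)
    (f : ('I_n -> A) -> A) : ('I_n -> A) -> A :=
  fun x => f (fun i => x i + h i) - f x.

(* P~(h_1,...,h_d) = Delta_{h_d} ... Delta_{h_1} P  (a constant function for deg P = d;
   we evaluate it at x = 0) *)
Definition Ptilde (A : finComNzRingType) (n d : nat) (P : {mpoly A[n]})
    (hs : 'I_d -> 'I_n -> A) : A :=
  foldl (fun g (j : 'I_d) => diffop (hs j) g) (fun x => P.@[x]) (enum 'I_d) (fun _ => 0).

Definition evec (A : finComNzRingType) (n : nat) (i : 'I_n) : 'I_n -> A :=
  fun k => (k == i)%:R.

(* P^ : the reduction mod p (via psi : A_l -> F_q) of the multilinear form P~,
   as a polynomial over F_q in the d*n variables h_j(i) (variable mxvec_index j i):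
   P^ = sum_{t : [d] -> [n]} psi(P~(e_{t 1},...,e_{t d})) prod_j h_j(t j). *)
Definition Phat (A : finComNzRingType) (F : finFieldType) (psi : A -> F)
    (n d : nat) (P : {mpoly A[n]}) : {mpoly F[d * n]} :=
  \sum_(t : {ffun 'I_d -> 'I_n})
     psi (Ptilde P (fun j => evec A (t j))) *: \prod_(j < d) 'X_(mxvec_index j (t j)).

Definition schmidt_decomp (F : fieldType) (m : nat) (Q : {mpoly F[m]}) (d r : nat) : Prop :=
  exists Qs Rs : 'I_r -> {mpoly F[m]},
    (forall i, (msize (Qs i) <= d)%N /\ (msize (Rs i) <= d)%N) /\
    Q = \sum_(i < r) Qs i * Rs i.

Definition schmidt_rank_ge (F : fieldType) (m : nat) (Q : {mpoly F[m]}) (d r : nat) : Prop :=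
  forall r', (r' < r)%N -> ~ schmidt_decomp Q d r'.

(* Main.v *)
(* Write [q] for the order of the residue field and [k] for the level of the
   character [chi].  Differencing [d] times bounds [|b|^(2^d)] by the bias of the
   multilinear form [Ptilde] over [A].

   From level [k] to level 1: a form with bias at least [q^-(sk)] for a character
   of level [k] has, modulo [p], bias bounded below independently of [k].  By
   induction on the arity, many slices [T_v] are biased, say for [v] in [X].
   Viewing [A^n] as a tree of cosets of [p^i A^n], the density of [X] forces some
   node of level [i <= k/2] at which [X] meets a positive proportion of the
   children; differences [p^i w] of elements of [X] in that node give biased slices
   (bias is supermultiplicative in the form), hence [T_w] is biased at level
   [k - i], and induction applies to [T_w] for a positive proportion of [w] mod [p].

   From bias to rank over a finite field, uniformly in [q]: by induction on the
   arity, the [v] for which [T_v] has bounded rank contain a dense cone, and a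
   bounded sumset of a dense cone is a subspace of bounded codimension.  All forms
   of arity [d - 1] and rank at most [R] satisfy a common nonzero identity
   [sum_s c_s prod_a T(X_1(s_1 a), X_2(s_2 a), ...) = 0], with one permutation for
   each direction, because there are more monomials than functions they can be
   made of.  Polarizing in the last variable gives an identity for [T] on the
   subspace, and expanding an identity of minimal length around a point where one
   of its coefficients does not vanish expresses [T] through products of forms of
   lower arity. *)
Require Import Defs.
From HB Require Import structures.
From mathcomp Require Import all_boot all_order all_algebra all_fingroup all_field.
From mathcomp Require Import mpoly zify ring.
Set Implicit Arguments. Unset Strict Implicit. Unset Printing Implicit Defensive.
Import Order.TTheory GRing.Theory Num.Theory.
Local Open Scope ring_scope.

(** * Averages and additive characters *)

Definition avg (T : finType) (f : T -> algC) : algC := (\sum_x f x) / #|T|%:R.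

Lemma eq_avg (T : finType) (f g : T -> algC) : f =1 g -> avg f = avg g.
Proof. by move=> fg; rewrite /avg (eq_bigr g) // => x _; apply: fg. Qed.

Lemma avg_ge0 (T : finType) (f : T -> algC) : (forall x, 0 <= f x) -> 0 <= avg f.
Proof. by move=> f0; rewrite divr_ge0 ?ler0n // sumr_ge0. Qed.

Lemma avg_le (T : finType) (f g : T -> algC) :
  (forall x, f x <= g x) -> avg f <= avg g.
Proof. by move=> fg; rewrite ler_wpM2r ?invr_ge0 ?ler0n ?ler_sum. Qed.

Lemma norm_avg (T : finType) (f : T -> algC) : `|avg f| <= avg (fun x => `|f x|).
Proof.
by rewrite normrM [X in _ * X]ger0_norm ?invr_ge0 ?ler0n // ler_wpM2r ?invr_ge0 ?ler0n ?ler_norm_sum.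
Qed.

Lemma avgD (T : finType) (f g : T -> algC) :
  avg (fun x => f x + g x) = avg f + avg g.
Proof. by rewrite /avg big_split mulrDl. Qed.

Lemma avgZ (T : finType) c (f : T -> algC) : avg (fun x => c * f x) = c * avg f.
Proof. by rewrite /avg -mulr_sumr mulrA. Qed.

Lemma avgZr (T : finType) c (f : T -> algC) : avg (fun x => f x * c) = avg f * c.
Proof. by rewrite mulrC -avgZ; apply: eq_avg => x; rewrite mulrC. Qed.

Lemma avg_conj (T : finType) (f : T -> algC) : (avg f)^* = avg (fun x => (f x)^*).
Proof. by rewrite /avg rmorphM rmorph_sum fmorphV rmorph_nat. Qed.

Lemma avg_const (T : finType) (t0 : T) c : avg (fun _ : T => c) = c.
Proof.
rewrite /avg sumr_const -[c *+ _]mulr_natr mulfK // pnatr_eq0 -lt0n.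
by apply/card_gt0P; exists t0.
Qed.

Lemma avg_exchange (S T : finType) (f : S -> T -> algC) :
  avg (fun x => avg (f x)) = avg (fun y => avg (f^~ y)).
Proof. by rewrite /avg -!mulr_suml exchange_big /= mulrAC. Qed.

Lemma avg_bij (S T : finType) (h : S -> T) (f : T -> algC) :
  bijective h -> avg (fun x => f (h x)) = avg f.
Proof.
move=> bh; rewrite /avg (bij_eq_card bh); congr (_ / _).
by rewrite [RHS](reindex h) //; apply: onW_bij.
Qed.

Lemma avg_addr (V : finZmodType) (u : V) (f : V -> algC) :
  avg (fun x => f (x + u)) = avg f.
Proof. by apply: avg_bij; exists (fun x => x - u) => x; rewrite ?addrK ?subrK. Qed.

Lemma avg_addl (V : finZmodType) (u : V) (f : V -> algC) :
  avg (fun x => f (u + x)) = avg f.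
Proof. by rewrite -(avg_addr u); apply: eq_avg => x; rewrite addrC. Qed.

Lemma avg_sqr_le (T : finType) (t0 : T) (f : T -> algC) :
  (forall x, 0 <= f x) -> avg f ^+ 2 <= avg (fun x => f x ^+ 2).
Proof.
move=> f0; set a := avg f.
have a0 : 0 <= a by apply: avg_ge0.
have : 0 <= avg (fun x => (f x - a) ^+ 2).
  apply: avg_ge0 => x; rewrite real_exprn_even_ge0 //.
  by rewrite rpredB ?ger0_real.
have -> : avg (fun x => (f x - a) ^+ 2) = avg (fun x => f x ^+ 2) - a ^+ 2.
  rewrite (eq_avg (g := fun x => f x ^+ 2 + ((- (2 * a)) * f x + a ^+ 2))); last first.
    by move=> x; ring.
  by rewrite !avgD avgZ avg_const // -/a; ring.
by rewrite subr_ge0.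
Qed.

(** Points with [f x] below [t] contribute at most [t] to the average and the others at most 1 each,
    so the others have proportion at least [t]. *)
Lemma avg_markov (T : finType) (f : T -> algC) (t : algC) :
  (forall x, 0 <= f x <= 1) -> 0 <= t -> t *+ 2 <= avg f ->
  #|T|%:R * t <= #|[set x | t <= f x]|%:R.
Proof.
move=> f01 t0 tf.
have [c0|c0] := posnP #|T|; first by rewrite c0 mul0r ler0n.
have cR : (0 : algC) < #|T|%:R by rewrite ltr0n.
have : \sum_x f x <= #|[set x | t <= f x]|%:R + #|T|%:R * t.
  rewrite (bigID [pred x | t <= f x]) /= lerD //.
    rewrite cardsE -sum1_card natr_sum ler_sum // => x _.
    by case/andP: (f01 x).
  apply: (@le_trans _ _ (\sum_(x | ~~ (t <= f x)) t)).
    apply: ler_sum => x ntf; apply: ltW; rewrite real_ltNge // ?ger0_real //.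
    by case/andP: (f01 x).
  rewrite sumr_const -[t *+ _]mulr_natl ler_wpM2r // ler_nat.
  exact: max_card.
move: tf; rewrite /avg ler_pdivlMr // => /le_trans h /h.
by rewrite mulr2n mulrDl [t * _]mulrC lerD2r.
Qed.

Section Characters.
Variables (A : finComNzRingType) (chi : A -> algC).
Hypothesis chiP : add_char chi.

Lemma add_charD x y : chi (x + y) = chi x * chi y. Proof. exact: chiP.1. Qed.

Lemma add_char0 : chi 0 = 1.
Proof. by apply: (mulfI (chiP.2 0)); rewrite -add_charD addr0 mulr1. Qed.

Lemma add_char_norm x : `|chi x| = 1.
Proof.
(* Translation by [x] permutes the factors of the product of all values of [chi], so [chi x] is a
   root of unity. *)
have h : chi x ^+ #|A| = 1.
  have nz : \prod_(y : A) chi y != 0 by apply/prodf_neq0 => y _; apply: chiP.2.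
  apply: (mulIf nz); rewrite mul1r
    -prodr_const -big_split /= [RHS](reindex (fun y => x + y)) /=.
    by apply: eq_bigr => y _; rewrite add_charD.
  by exists (fun y => y - x) => y _; rewrite addrC ?addKr ?subrK // addrAC subrr add0r.
have := congr1 (fun z => `|z|) h; rewrite /= normrX normr1 => /eqP.
rewrite pexpr_eq1 // => [/eqP //|]; by apply/card_gt0P; exists 0.
Qed.

Lemma add_charN x : chi (- x) = (chi x)^*.
Proof.
apply: (mulIf (chiP.2 x)); rewrite -add_charD addNr add_char0.
by rewrite mulrC -normCK add_char_norm expr1n.
Qed.

Lemma add_char_scale a : add_char (fun x => chi (a * x)).
Proof. by split=> [x y|x]; rewrite ?mulrDr ?add_charD //; apply: chiP.2. Qed.

(** Orthogonality: translating by [u] multiplies the average by [chi (g u)]. That the result is 0 or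
    1 makes biases nonnegative reals. *)
Lemma avg_char_additive (V : finZmodType) (g : V -> A) :
  (forall u v, g (u + v) = g u + g v) ->
  avg (fun v => chi (g v)) = [forall v, chi (g v) == 1]%:R.
Proof.
move=> gD; case: forallP => [h|h].
  by rewrite (eq_avg (g := fun=> 1)) ?(avg_const 0) // => v; apply/eqP/h.
have [u hu] : exists u, chi (g u) != 1.
  apply/existsP; rewrite -negb_forall; apply/forallP => k; apply: h => v; exact: k.
have : chi (g u) * avg (fun v => chi (g v)) = avg (fun v => chi (g v)).
  rewrite -avgZ -[RHS](avg_addl u); apply: eq_avg => v.
  by rewrite gD add_charD.
move/eqP; rewrite -subr_eq0 -[X in _ - X]mul1r -mulrBl mulf_eq0 subr_eq0 (negPf hu).
by move/eqP.
Qed.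

End Characters.

(** * Multilinear forms and bias *)

Definition upd (I : finType) (V : Type) (x : {ffun I -> V}) (i : I) (v : V) :
  {ffun I -> V} := [ffun j => if j == i then v else x j].

Section Update.
Variables (I : finType) (V : Type).
Implicit Types (x : {ffun I -> V}) (i j : I) (u v : V).

Lemma updE x i v j : upd x i v j = if j == i then v else x j.
Proof. by rewrite ffunE. Qed.

Lemma upd_id x i : upd x i (x i) = x.
Proof. by apply/ffunP => j; rewrite updE; case: eqP => [->|]. Qed.

Lemma upd_upd x i u v : upd (upd x i u) i v = upd x i v.
Proof. by apply/ffunP => j; rewrite !updE; case: eqP. Qed.

Lemma updC x i j u v : i != j -> upd (upd x i u) j v = upd (upd x j v) i u.
Proof.
move=> ij; apply/ffunP => k; rewrite !updE.
by case: (k =P j) => [->|//]; rewrite eq_sym (negPf ij).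
Qed.

End Update.

Lemma avg_upd (I : finType) (V : finZmodType) (i : I) (f : {ffun I -> V} -> algC) :
  avg f = avg (fun v => avg (fun x => f (upd x i v))).
Proof.
rewrite [RHS]avg_exchange.
rewrite [RHS](eq_avg (g := fun x => avg (fun v => f (upd x i (v + x i))))); last first.
  by move=> x; rewrite (avg_addr _ (fun v => f (upd x i v))).
rewrite [RHS]avg_exchange [RHS](eq_avg (g := fun=> avg f)) ?(avg_const 0) //.
move=> v.
apply: (@avg_bij _ _ (fun x => upd x i (v + x i)) f).
exists (fun x => upd x i (x i - v)) => x;
  by rewrite !upd_upd updE eqxx [v + _]addrC ?addrK ?subrK upd_id.
Qed.

(** The form takes families over all of [I] but reads only the directions in [D], so fixing a
    direction shrinks [D] without changing the type. *)
Definition mlin (I : finType) (R : finComNzRingType) (n : nat) (D : {set I})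
    (T : {ffun I -> 'rV[R]_n} -> R) : Prop :=
  (forall x y : {ffun I -> 'rV[R]_n},
     (forall i, i \in D -> x i = y i) -> T x = T y) /\
  (forall i, i \in D -> forall x a u v,
     T (upd x i (a *: u + v)) = a * T (upd x i u) + T (upd x i v)).

Definition bias (I : finType) (R : finComNzRingType) (n : nat) (chi : R -> algC)
    (T : {ffun I -> 'rV[R]_n} -> R) : algC := avg (fun x => chi (T x)).

Section Multilinear.
Variables (I : finType) (R : finComNzRingType) (n : nat).
Local Notation V := 'rV[R]_n.
Implicit Types (D : {set I}) (T : {ffun I -> V} -> R) (x y : {ffun I -> V}).

Lemma mlin_ext D T T' : T =1 T' -> mlin D T -> mlin D T'.
Proof.
move=> e [h1 h2]; split=> [x y xy|i iD x a u v]; rewrite -!e; first exact: h1.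
exact: h2.
Qed.

Lemma mlin_updD D T i x u v : mlin D T -> i \in D ->
  T (upd x i (u + v)) = T (upd x i u) + T (upd x i v).
Proof. by move=> [_ h] iD; have := h i iD x 1 u v; rewrite scale1r mul1r. Qed.

Lemma mlin_upd0 D T i x : mlin D T -> i \in D -> T (upd x i 0) = 0.
Proof.
move=> h iD; have := mlin_updD x 0 0 h iD; rewrite addr0 => /eqP.
by rewrite -subr_eq subrr eq_sym => /eqP.
Qed.

Lemma mlin_updZ D T i x a u : mlin D T -> i \in D ->
  T (upd x i (a *: u)) = a * T (upd x i u).
Proof.
move=> h iD; have := h.2 i iD x a u 0.
by rewrite addr0 (mlin_upd0 _ h iD) addr0.
Qed.

Lemma mlin_updN D T i x u : mlin D T -> i \in D ->
  T (upd x i (- u)) = - T (upd x i u).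
Proof. by move=> h iD; rewrite -scaleN1r (mlin_updZ _ _ _ h iD) mulN1r. Qed.

Lemma mlin_upd_sum D T i x (J : Type) (r : seq J) (P : pred J) (F : J -> V) :
  mlin D T -> i \in D ->
  T (upd x i (\sum_(j <- r | P j) F j)) = \sum_(j <- r | P j) T (upd x i (F j)).
Proof.
move=> h iD.
by apply: (big_morph (fun v => T (upd x i v))) => [u v|];
  [apply: mlin_updD h iD|apply: mlin_upd0 h iD].
Qed.

Lemma mlin_add D T T' : mlin D T -> mlin D T' -> mlin D (fun x => T x + T' x).
Proof.
move=> [h1 h2] [k1 k2]; split=> [x y xy|i iD x a u v].
  by rewrite (h1 x y) // (k1 x y).
by rewrite h2 // k2 //; ring.
Qed.

Lemma mlin_scale D T c : mlin D T -> mlin D (fun x => c * T x).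
Proof.
move=> [h1 h2]; split=> [x y xy|i iD x a u v]; first by rewrite (h1 x y).
by rewrite h2 //; ring.
Qed.

Lemma mlin_opp D T : mlin D T -> mlin D (fun x => - T x).
Proof.
by move=> h; apply: mlin_ext (mlin_scale (-1) h) => x; rewrite mulN1r.
Qed.

Lemma mlin0 D : mlin D (fun _ : {ffun I -> V} => 0).
Proof. by split=> // *; rewrite mulr0 addr0. Qed.

Lemma mlin_upd D T i v : mlin D T -> mlin (D :\ i) (fun x => T (upd x i v)).
Proof.
move=> [h1 h2]; split=> [x y xy|j]; last first.
  by rewrite !inE => /andP[ji jD] x a u w; rewrite ![upd (upd x j _) i _]updC // h2.
apply: h1 => j jD; rewrite !updE; case: eqP => // /eqP ji.
by apply: xy; rewrite !inE ji.
Qed.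

Section Bias.
Variables (chi : R -> algC).
Hypothesis chiP : add_char chi.

Lemma bias_upd i T : bias chi T = avg (fun v => bias chi (fun x => T (upd x i v))).
Proof. exact: avg_upd. Qed.

Lemma eq_bias T T' : T =1 T' -> bias chi T = bias chi T'.
Proof. by move=> e; apply: eq_avg => x; rewrite e. Qed.

(** For each [x], the average in direction [i] is a constant of modulus 1 times the average of a
    character of an additive map, which is 0 or 1; taking norms deletes the constant. *)
Lemma norm_avg_char_affine i (S : {ffun I -> V} -> R) :
  (forall x u v, S (upd x i (u + v)) - S (upd x i 0) =
     (S (upd x i u) - S (upd x i 0)) + (S (upd x i v) - S (upd x i 0))) ->
  `|bias chi S| <= bias chi (fun x => S x - S (upd x i 0)).
Proof.
move=> hS; rewrite /bias (avg_upd i) avg_exchange (le_trans (norm_avg _)) //.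
rewrite [leRHS](avg_upd i) [leRHS]avg_exchange; apply: avg_le => x.
set g := fun v => S (upd x i v) - S (upd x i 0).
rewrite (eq_avg (g := fun v => chi (S (upd x i 0)) * chi (g v))); last first.
  by move=> v; rewrite -add_charD // addrC subrK.
rewrite avgZ normrM add_char_norm // mul1r.
rewrite [leRHS](eq_avg (g := fun v => chi (g v))); last by move=> v; rewrite upd_upd.
by rewrite avg_char_additive ?ger0_norm ?ler0n // => u v; apply: hS.
Qed.

Lemma bias_ge0 D i T : mlin D T -> i \in D -> 0 <= bias chi T.
Proof.
move=> h iD; rewrite /bias (avg_upd i) avg_exchange; apply: avg_ge0 => x.
by rewrite avg_char_additive ?ler0n // => u v; apply: mlin_updD h iD.
Qed.

Lemma bias_norm_le1 T : `|bias chi T| <= 1.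
Proof.
apply: le_trans (norm_avg _) _; rewrite (eq_avg (g := fun=> 1)) ?(avg_const (0 : {ffun I -> V})) //.
by move=> x; apply: add_char_norm.
Qed.

Lemma bias_le1 D i T : mlin D T -> i \in D -> bias chi T <= 1.
Proof. by move=> h iD; rewrite -(ger0_norm (bias_ge0 h iD)) bias_norm_le1. Qed.

Lemma bias_opp D i T : mlin D T -> i \in D -> bias chi (fun x => - T x) = bias chi T.
Proof.
move=> h iD; rewrite -[RHS]conj_Creal ?ger0_real ?(bias_ge0 h iD) // [RHS]avg_conj.
by apply: eq_avg => x; apply: add_charN.
Qed.

(* Translating the argument of [T'] only adds terms of lower order, and these
   can be removed one direction at a time. *)
Lemma bias_shift_le D i T T' (y : {ffun I -> V}) : mlin D T -> mlin D T' -> i \in D ->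
  `|bias chi (fun x => T x + T' (x + y))| <= bias chi (fun x => T x + T' x).
Proof.
move=> hT hT' iD; pose yy (E : {set I}) : {ffun I -> V} := [ffun j => if j \in E then y j else 0].
have -> : bias chi (fun x => T x + T' (x + y)) = bias chi (fun x => T x + T' (x + yy D)).
  apply: eq_bias => x; congr (_ + _); apply: hT'.1 => j jD.
  by rewrite !ffunE jD.
suff main m (E : {set I}) : (#|E| <= m)%N -> E \subset D ->
    `|bias chi (fun x => T x + T' (x + yy E))| <= bias chi (fun x => T x + T' x).
  exact: main (leqnn _) (subxx _).
elim: m E => [|m IH] E cE ED.
  have -> : yy E = 0.
    apply/ffunP => j; rewrite !ffunE; move: cE; rewrite leqn0 cards_eq0 => /eqP ->.
    by rewrite inE.
  rewrite (eq_bias (T' := fun x => T x + T' x)) => [|x]; last by rewrite addr0.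
  by rewrite ger0_norm // (bias_ge0 (mlin_add hT hT') iD).
have [E0|[j jE]] := set_0Vmem E; first by apply: IH => //; rewrite E0 cards0.
have jD := subsetP ED _ jE.
have sh x v : upd x j v + yy E = upd (x + yy E) j (v + y j).
  by apply/ffunP => k; rewrite !ffunE; case: eqP => [->|//]; rewrite jE.
have e : bias chi (fun x => T x + T' (x + yy E) - (T (upd x j 0) + T' (upd x j 0 + yy E)))
     = bias chi (fun x => T x + T' (x + yy (E :\ j))).
  apply: eq_bias => x; rewrite (mlin_upd0 _ hT jD) add0r -addrA; congr (_ + _).
  rewrite sh add0r -[X in T' X - _](upd_id (x + yy E) j) [(x + yy E) j]ffunE.
  rewrite [yy E j]ffunE jE (mlin_updD _ _ _ hT' jD) addrK; congr T'.
  apply/ffunP => k; rewrite !ffunE !inE; case: eqP => [->|//] /=.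
  by rewrite addr0.
have st : `|bias chi (fun x => T x + T' (x + yy E))| <=
    bias chi (fun x => T x + T' (x + yy (E :\ j))).
  rewrite -e; apply: norm_avg_char_affine => x u v.
  rewrite !sh add0r (mlin_updD _ _ _ hT jD) -addrA.
  by rewrite !(mlin_updD _ _ _ hT' jD) (mlin_upd0 _ hT jD); ring.
apply: (le_trans st); apply: le_trans (real_ler_norm _) (IH _ _ _).
- by apply: ger0_real; apply: le_trans st.
- by move: cE; rewrite (cardsD1 j) jE.
- exact: subset_trans (subD1set _ _) ED.
Qed.

(** The product is the average over [y] of the biases of [T x + T' (x + y)], each bounded by the
    case [y = 0]. *)
Lemma bias_mul_le D i T T' : mlin D T -> mlin D T' -> i \in D ->
  bias chi T * bias chi T' <= bias chi (fun x => T x + T' x).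
Proof.
move=> hT hT' iD.
have <- : `|bias chi T * bias chi T'| = bias chi T * bias chi T'.
  by rewrite ger0_norm // mulr_ge0 ?(bias_ge0 hT iD) ?(bias_ge0 hT' iD).
have -> : bias chi T * bias chi T' =
    avg (fun y => bias chi (fun x => T x + T' (x + y))).
  rewrite /bias avg_exchange -avgZr; apply: eq_avg => x.
  rewrite -avgZ -(avg_bij (h := fun y => x + y)).
    by apply: eq_avg => y; rewrite add_charD.
  by exists (fun y => - x + y) => y; rewrite ?addKr ?addNKr.
apply: le_trans (norm_avg _) _.
rewrite -[leRHS](avg_const (0 : {ffun I -> V})); apply: avg_le => y.
exact: bias_shift_le hT hT' iD.
Qed.

Lemma bias_linear i T : mlin [set i] T ->
  bias chi T = [forall v, chi (T (upd 0 i v)) == 1]%:R.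
Proof.
move=> hT; rewrite -(avg_char_additive chiP) => [|u v]; last first.
  by apply: mlin_updD hT _; rewrite inE.
rewrite (bias_upd i); apply: eq_avg => v.
rewrite /bias (eq_avg (g := fun=> chi (T (upd 0 i v)))) => [|x].
  by rewrite (avg_const (0 : {ffun I -> V})).
by congr chi; apply: hT.1 => k; rewrite inE => /eqP ->; rewrite !updE eqxx.
Qed.

End Bias.
End Multilinear.

Lemma card_set_sum (T : finType) (P : pred T) :
  #|[set x | P x]| = (\sum_x P x)%N.
Proof. by rewrite cardsE -sum1_card [LHS]big_mkcond; apply: eq_bigr => x _; rewrite unfold_in; case: (P x). Qed.

(** * From level [k] to level 1 *)

Section Tree.
Variables (A : finComNzRingType) (p : A) (n : nat).
Local Notation V := 'rV[A]_n.
Variables (X : {set V}) (q c : nat).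

(* The nodes at level [i] of the tree are the cosets [x + p^i V].  A level at which [X]
   meets less than a proportion [q^-c] of the children multiplies the density of [X]
   in some child by more than [q^c], and densities do not exceed 1. *)
Lemma exists_wide_node (g i : nat) (x : V) :
  (#|V| < #|[set u : V | (x + p ^+ i *: u)%R \in X]| * q ^ (c * g))%N ->
  exists (i' : nat) (x' : V), (i <= i' < i + g)%N /\
    (#|V| <= q ^ c *
       #|[set w : V | [exists u, (x' + p ^+ i' *: (w + p *: u))%R \in X]]|)%N.
Proof.
elim: g i x => [|g IH] i x.
  by rewrite muln0 muln1 ltnNge max_card.
set B := [set w : V | [exists u, x + p ^+ i *: (w + p *: u) \in X]] => big.
have [wide|narrow] := leqP #|V| (q ^ c * #|B|).
  by exists i, x; rewrite leqnn addnS ltnS leq_addr.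
pose a w := #|[set u : V | (x + p ^+ i *: w) + p ^+ i.+1 *: u \in X]|.
(* Here [w] runs over all of [V], so each child is counted once per representative; for fixed [u]
   the shift by [p *: u] permutes the [w]. *)
have suma : (#|V| * #|[set u : V | (x + p ^+ i *: u)%R \in X]| = \sum_(w in B) a w)%N.
  have -> : (\sum_(w in B) a w = \sum_w a w)%N.
    rewrite [RHS](bigID (mem B)) /= [X in (_ + X)%N]big1 ?addn0 // => w.
    rewrite inE => /existsPn nw; apply/eqP; rewrite cards_eq0 -subset0.
    apply/subsetP => u; rewrite !inE -addrA exprSr -scalerA -scalerDr => h.
    by have := nw u; rewrite h.
  rewrite /a; under eq_bigr => w _ do rewrite card_set_sum.
  rewrite exchange_big /= -sum_nat_const; apply: eq_bigr => u _.
  rewrite card_set_sum (reindex (fun w => w + p *: u)) /=; last first.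
    by exists (fun w => w - p *: u) => w _; rewrite ?addrK ?subrK.
  by apply: eq_bigr => w _; rewrite exprSr -scalerA scalerDr addrA.
have [w _ aw] : exists2 w, w \in B & (#|V| < a w * q ^ (c * g))%N.
  apply/exists_inP; rewrite -[X in is_true X]negbK negb_exists_in.
  apply/negP => /forall_inP h.
  have : (\sum_(w in B) a w * q ^ (c * g) <= #|B| * #|V|)%N.
    by rewrite -sum_nat_const; apply: leq_sum => w /h; rewrite -leqNgt.
  rewrite -big_distrl /= -suma -mulnA mulnC leq_pmul2r => [h2|]; last first.
    by apply/card_gt0P; exists 0.
  move: big; rewrite mulnS expnD mulnCA => big.
  have := leq_trans big (leq_mul (leqnn (q ^ c)) h2).
  by rewrite ltnNge ltnW.
have [i' [x' [/andP[h1 h2] h3]]] := IH _ _ aw.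
by exists i', x'; split=> //; rewrite (ltnW h1) addnS -addSn.
Qed.

End Tree.

Lemma exprn_antimono (Q : algC) a b : 0 <= Q <= 1 -> (a <= b)%N -> Q ^+ b <= Q ^+ a.
Proof. by case/andP=> Q0 Q1 ab; apply: ler_wiXn2l. Qed.

Section Lifting.
Variable I : finType.

(* The loss from [s] to [S] is independent of the level [j]: the slices produced by
   [exists_wide_node] have level at least [j/2], so the exponent [s] only grows by a
   constant factor at each step of the induction on the arity. *)
Theorem bias_reduction (m s : nat) : exists S : nat,
  forall (q : nat) (A : finComNzRingType) (n : nat) (p : A) (D : {set I})
    (T : {ffun I -> 'rV[A]_n} -> A) (chi : A -> algC) (j : nat),
  (1 < q)%N -> #|D| = m.+1 -> mlin D T -> add_char chi -> (0 < j)%N ->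
  (forall a, chi (p ^+ j * a) = 1) ->
  q%:R^-1 ^+ (s * j) <= bias chi T ->
  q%:R^-1 ^+ S <= bias (fun a => chi (p ^+ j.-1 * a)) T.
Proof.
elim: m s => [|m IH] s.
  exists 0%N => q A n p D T chi j q1 cD hT hchi j0 chij.
  have [i Di] : exists i, D = [set i] by apply/cards1P; rewrite cD.
  have iD : i \in D by rewrite Di inE.
  rewrite Di in hT iD; rewrite (bias_linear hchi hT).
  rewrite (bias_linear (add_char_scale hchi (p ^+ j.-1)) hT).
  case: forallP => [h _|_].
    rewrite expr0; case: forallP => [//|[]] v.
    by rewrite -(mlin_updZ _ _ _ hT iD) h.
  have pos : 0 < (q%:R^-1 : algC) ^+ (s * j).
    by rewrite exprn_gt0 ?invr_gt0 ?ltr0n ?(ltnW q1).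
  by move/(lt_le_trans pos); rewrite ltxx.
(* Two slices of bias at least [q^-((s+1)j)] have a difference of bias at least [q^-(2(s+1)j)],
   which is used at a level above [j/2]; hence the 4. *)
have [S' HS'] := IH (4 * s.+1)%N.
exists (2 * s + 3 + S')%N => q A n p D T chi j q1 cD hT hchi j0 chij.
set Q : algC := q%:R^-1 => big.
have q0 : (0 < q)%N by apply: ltnW.
have qR : (0 : algC) < q%:R by rewrite ltr0n.
have Q0 : 0 < Q by rewrite invr_gt0.
have Q01 : 0 <= Q <= 1 by rewrite ltW // invf_le1 // ler1n.
have Q2 : Q *+ 2 <= 1.
  by rewrite -mulr_natl /Q ler_pdivrMr // mul1r ler_nat.
have [i iD] : exists i, i \in D by apply/card_gt0P; rewrite cD.
set D' := D :\ i.
have cD' : #|D'| = m.+1 by move: cD; rewrite (cardsD1 i) iD => -[].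
have [i' iD'] : exists i', i' \in D' by apply/card_gt0P; rewrite cD'.
pose Tv v := fun x => T (upd x i v).
have hTv v : mlin D' (Tv v) by apply: mlin_upd.
pose X := [set v | Q ^+ (s.+1 * j) <= bias chi (Tv v)].
have cX : #|'rV[A]_n|%:R * Q ^+ (s.+1 * j) <= #|X|%:R.
  apply: avg_markov.
  - by move=> v; rewrite (bias_ge0 hchi (hTv v) iD') (bias_le1 hchi (hTv v) iD').
  - by rewrite exprn_ge0 // ltW.
  rewrite -bias_upd //; apply: le_trans big.
  (* The factor [Q ^+ j] split off here is at most 1/2 and absorbs the 2 lost in [avg_markov]. *)
  rewrite mulSn exprD -mulrnAl -[leRHS]mul1r ler_wpM2r ?exprn_ge0 ?(ltW Q0) //.
  apply: le_trans Q2; rewrite lerMn2r /= -[leRHS]expr1.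
  exact: exprn_antimono.
(* The depth [g] is [j/2] rounded up and [c] exceeds [2 * s.+1], so [q ^ (c * g)] outweighs the
   density of [X], and the wide node has level below [j/2]. *)
set c := (2 * s + 3)%N; pose g := uphalf j.
have gj : (s.+1 * j < c * g)%N by rewrite /c /g; have := odd_double_half j; rewrite uphalf_half; clear -j0; nia.
have VX : (#|'rV[A]_n| < #|[set u : 'rV[A]_n | (0 + p ^+ 0 *: u)%R \in X]| * q ^ (c * g))%N.
  have -> : [set u : 'rV[A]_n | 0 + p ^+ 0 *: u \in X] = X.
    by apply/setP => u; rewrite inE add0r expr0 scale1r.
  have : (#|'rV[A]_n| <= #|X| * q ^ (s.+1 * j))%N.
    move: cX; rewrite exprVn ler_pdivrMr ?exprn_gt0 //.
    by rewrite -natrX -natrM ler_nat.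
  move/leq_ltn_trans; apply.
  rewrite ltn_pmul2l ?ltn_exp2l //.
  rewrite -(ltr_nat algC); apply: lt_le_trans cX.
  rewrite mulr_gt0 ?exprn_gt0 // ltr0n; by apply/card_gt0P; exists 0.
have [i0 [x [/andP[_ i0g] wide]]] := exists_wide_node VX.
set B := [set w : 'rV[A]_n | _] in wide.
have i0j : (2 * i0 < j)%N by move: i0g; rewrite add0n /g uphalf_half; have := odd_double_half j; clear; lia.
have ltj : (i0 < j)%N by clear -i0j; lia.
have [w0 w0B] : exists w0, w0 \in B.
  apply/card_gt0P; rewrite lt0n; apply/eqP => B0; move: wide; rewrite B0 muln0 leqn0.
  by apply/negP; rewrite -lt0n; apply/card_gt0P; exists 0.
(* Two vectors of [X] in one node differ by [p ^+ i0] times [w1 - w2]. That power moves into the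
   character, and the terms [p *: u] and [p *: u0] vanish at level 1. *)
have Bdiff w : w \in B -> Q ^+ S' <= bias (fun a => chi (p ^+ j.-1 * a)) (Tv (w - w0)).
  rewrite inE => /existsP[u hu]; move: w0B; rewrite inE => /existsP[u0 hu0].
  set w1 := w + p *: u in hu; set w2 := w0 + p *: u0 in hu0.
  have hchi' := add_char_scale hchi (p ^+ i0).
  have l1 : Q ^+ (4 * s.+1 * (j - i0)) <= bias (fun a => chi (p ^+ i0 * a)) (Tv (w1 - w2)).
    have -> : bias (fun a => chi (p ^+ i0 * a)) (Tv (w1 - w2)) =
        bias chi (fun y => Tv (x + p ^+ i0 *: w1) y + - Tv (x + p ^+ i0 *: w2) y).
      rewrite /bias; apply: eq_avg => y; congr chi.
      rewrite /Tv -(mlin_updZ _ _ _ hT iD) -(mlin_updN _ _ hT iD) -(mlin_updD _ _ _ hT iD).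
      by rewrite [- (x + _)]opprD addrACA subrr add0r -scalerBr.
    have := bias_mul_le hchi (hTv (x + p ^+ i0 *: w1)) (mlin_opp (hTv (x + p ^+ i0 *: w2))) iD'.
    apply: le_trans; rewrite (bias_opp hchi (hTv _) iD').
    move: hu hu0; rewrite !inE => hu hu0.
    apply: (@le_trans _ _ (Q ^+ (s.+1 * j) * Q ^+ (s.+1 * j))).
      have l4 : (j + j <= 4 * (j - i0))%N by clear -i0j; lia.
      rewrite -exprD; apply: exprn_antimono => //.
      by rewrite -mulnDr [(4 * _)%N]mulnC -mulnA leq_mul2l l4 orbT.
    by apply: ler_pM => //; rewrite exprn_ge0 // ltW.
  have := HS' q A n p D' (Tv (w1 - w2)) _ (j - i0)%N q1 cD' (hTv _) hchi' _ _ l1.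
  rewrite subn_gt0 => H; have {}H := H ltj.
  apply: le_trans (H _) _.
    by move=> a; rewrite mulrA -exprD subnKC ?chij // ltnW.
  rewrite le_eqVlt; apply/orP; left; apply/eqP; apply: eq_avg => y.
  rewrite mulrA -exprD; have -> : (i0 + (j - i0).-1 = j.-1)%N by clear -i0j; lia.
  have -> : w1 - w2 = (w - w0) + p *: (u - u0).
    by rewrite /w1 /w2 opprD addrACA -scalerBr.
  rewrite /Tv (mlin_updD _ _ _ hT iD) (mlin_updZ _ _ _ hT iD) mulrDr add_charD //.
  by rewrite mulrA -exprSr prednK // chij mulr1.
rewrite (bias_upd _ i) -(avg_addr (- w0)) /avg ler_pdivlMr; last first.
  by rewrite ltr0n; apply/card_gt0P; exists 0.
apply: (@le_trans _ _ (\sum_(w in B) Q ^+ S')); last first.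
  rewrite [leRHS](bigID (mem B)) /= -[leLHS]addr0 lerD //.
    by apply: ler_sum => w /Bdiff.
  by apply: sumr_ge0 => w _; apply: bias_ge0 (hTv _) iD'; apply: add_char_scale.
rewrite sumr_const -[_ *+ #|B|]mulr_natl exprD mulrAC ler_wpM2r ?exprn_ge0 ?(ltW Q0) //.
by rewrite exprVn mulrC ler_pdivrMr ?exprn_gt0 // -natrX -natrM ler_nat mulnC.
Qed.

End Lifting.

(** * Partition rank and polynomial identities *)

(* Partition rank.  When [#|D| = 1] there is no admissible [J], and only the zero
   form has finite rank. *)
Inductive prank_le (I : finType) (R : finComNzRingType) (n : nat) (D : {set I}) :
    nat -> ({ffun I -> 'rV[R]_n} -> R) -> Prop :=
| prank_zero r T : (forall x, T x = 0) -> prank_le D r T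
| prank_step r (J : {set I}) Q G T T' : J != set0 -> J \proper D ->
    mlin J Q -> mlin (D :\: J) G -> prank_le D r T' ->
    (forall x, T x = Q x * G x + T' x) -> prank_le D r.+1 T.

Section PartitionRank.
Variables (I : finType) (R : finComNzRingType) (n : nat) (D : {set I}).
Local Notation V := 'rV[R]_n.
Implicit Types (T Q G : {ffun I -> V} -> R) (J : {set I}).

Lemma prank_ext r T T' : T =1 T' -> prank_le D r T -> prank_le D r T'.
Proof.
move=> e h; case: h e => [k S S0 e|k J Q G S S' J0 JD hQ hG hS' eS e].
  by apply: prank_zero => x; rewrite -e.
by apply: (prank_step J0 JD hQ hG hS') => x; rewrite -e.
Qed.

Lemma prank_mono r r' T : (r <= r')%N -> prank_le D r T -> prank_le D r' T.
Proof.
move=> rr h; elim: h r' rr => [k S S0 r' _|k J Q G S S' J0 JD hQ hG _ IH eS [//|r'] rr].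
  exact: prank_zero.
exact: prank_step J0 JD hQ hG (IH _ rr) eS.
Qed.

Lemma prank_add r r' T T' : prank_le D r T -> prank_le D r' T' ->
  prank_le D (r + r') (fun x => T x + T' x).
Proof.
move=> h h'; elim: h => [k S S0|k J Q G S S' J0 JD hQ hG _ IH eS].
  apply: prank_mono (leq_addl _ _) _; apply: prank_ext h' => x.
  by rewrite S0 add0r.
rewrite addSn; apply: prank_step J0 JD hQ hG IH _ => x.
by rewrite eS addrA.
Qed.

Lemma prank_scale r c T : prank_le D r T -> prank_le D r (fun x => c * T x).
Proof.
elim=> [k S S0|k J Q G S S' J0 JD hQ hG _ IH eS].
  by apply: prank_zero => x; rewrite S0 mulr0.
by apply: prank_step J0 JD (mlin_scale c hQ) hG IH _ => x; rewrite eS mulrDr mulrA.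
Qed.

Lemma prank_mul J Q G : J != set0 -> J \proper D -> mlin J Q -> mlin (D :\: J) G ->
  prank_le D 1 (fun x => Q x * G x).
Proof.
move=> J0 JD hQ hG; apply: prank_step J0 JD hQ hG (@prank_zero _ _ _ D 0 (fun=> 0) _) _ => //.
by move=> x; rewrite addr0.
Qed.

Lemma prank_sum (K : finType) (P : pred K) (F : K -> {ffun I -> V} -> R) :
  (forall k, P k -> prank_le D 1 (F k)) ->
  prank_le D #|K| (fun x => \sum_(k | P k) F k x).
Proof.
move=> hF; rewrite cardE; have := erefl (enum K); rewrite [in RHS]enumT => eK.
suff H s : prank_le D (size s) (fun x => \sum_(k <- s | P k) F k x).
  by apply: prank_ext (H (enum K)) => x; rewrite big_enum_cond.
elim: s => [|k s IH]; first by apply: prank_zero => x; rewrite big_nil.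
have [Pk|nPk] := boolP (P k).
  by apply: prank_ext (prank_add (hF _ Pk) IH) => x; rewrite big_cons Pk.
by apply: prank_mono (leqnSn _) _; apply: prank_ext IH => x; rewrite big_cons (negPf nPk).
Qed.

End PartitionRank.

(* For [sigma] a family of permutations of ['I_N], the monomial
   [\prod_a T (select X sigma a)] involves every vector [X (i, b)] exactly once. *)
Definition select (I : finType) (V : Type) (N : nat) (X : {ffun I * 'I_N -> V})
    (sigma : {ffun I -> {perm 'I_N}}) (a : 'I_N) : {ffun I -> V} :=
  [ffun i => X (i, sigma i a)].

Definition normalized (I : finType) (N : nat) (D : {set I}) (i0 : I)
    (sigma : {ffun I -> {perm 'I_N}}) : Prop :=
  sigma i0 = 1%g /\ (forall i, i \notin D -> sigma i = 1%g).

Definition identity_for (I : finType) (R : finComNzRingType) (n N : nat)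
    (c : {ffun I -> {perm 'I_N}} -> R) (T : {ffun I -> 'rV[R]_n} -> R) : Prop :=
  forall X : {ffun I * 'I_N -> 'rV[R]_n},
    \sum_sigma c sigma * \prod_a T (select X sigma a) = 0.

Section IdentityToRank.
Variables (I : finType) (F : finFieldType) (n N : nat) (D : {set I}) (i0 : I).
Variable T : {ffun I -> 'rV[F]_n} -> F.
Hypotheses (i0D : i0 \in D) (mT : mlin D T).
Local Notation Sg := {ffun I -> {perm 'I_N}}.
Local Notation V := 'rV[F]_n.

Lemma mlin_merge (J : {set I}) (z : {ffun I -> V}) :
  mlin (D :&: J) (fun y : {ffun I -> V} => T [ffun i => if i \in J then y i else z i]).
Proof.
split=> [x y xy|i].
  apply: mT.1 => i iD; rewrite !ffunE; case: ifP => // iJ.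
  by apply: xy; rewrite inE iD.
rewrite inE => /andP[iD iJ] x a u v.
have e w : [ffun k => if k \in J then upd x i w k else z k] =
    upd [ffun k => if k \in J then x k else z k] i w.
  by apply/ffunP => k; rewrite !ffunE; case: (k =P i) => [->|//]; rewrite iJ.
by rewrite !e (mT.2 i iD).
Qed.

Section Step.
Variables (al : I -> 'I_N) (X0 : {ffun I * 'I_N -> V}).

Let Xy (y : {ffun I -> V}) : {ffun I * 'I_N -> V} :=
  [ffun ib => if ib.2 == al ib.1 then y ib.1 else X0 ib].

(** The vector [y i] occurs only in the factor with index [(sigma i)^-1 (al i)]. This index is [a],
    outside [B], when [sigma i a = al i], and otherwise lies in [B]. *)
Lemma mlin_select_prod (sigma : Sg) (a : 'I_N) (B : {set 'I_N}) :
  a \notin B ->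
  (forall i, sigma i a != al i -> (sigma i)^-1%g (al i) \in B) ->
  mlin (D :\: [set i | sigma i a == al i])
    (fun y => \prod_(b in B) T (select (Xy y) sigma b)).
Proof.
move=> aB hB; split=> [x y xy|i].
  apply: eq_bigr => b bB; apply: mT.1 => i iD; rewrite !ffunE /=.
  case: eqP => // eb; apply: xy; rewrite !inE iD andbT; apply/eqP => ea.
  by move: aB; rewrite -(perm_inj (etrans eb (esym ea))) bB.
rewrite !inE => /andP[ia iD] x c u v.
have b0B := hB i ia; set b0 : 'I_N := fun_of_perm _ _ in b0B.
have e1 w : select (Xy (upd x i w)) sigma b0 = upd (select (Xy x) sigma b0) i w.
  apply/ffunP => k; rewrite !ffunE /=; case: (k =P i) => [->|//].
  by rewrite permKV eqxx.
have e2 w b : b != b0 -> select (Xy (upd x i w)) sigma b = select (Xy x) sigma b.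
  move=> bb; apply/ffunP => k; rewrite !ffunE /=; case: (k =P i) => [->|//].
  case: eqP => // eb; case/negP: bb; apply/eqP.
  by rewrite /b0 -eb permK.
rewrite !(bigD1 b0 b0B) /= !e1 mT.2 //.
have e3 w : \prod_(b in B | b != b0) T (select (Xy (upd x i w)) sigma b) =
    \prod_(b in B | b != b0) T (select (Xy x) sigma b).
  by apply: eq_bigr => b /andP[_ /e2->].
by rewrite !e3; ring.
Qed.

End Step.

(* If the coefficient of the entry with index [a] in an identity does not vanish,
   expanding the identity around a point where it is nonzero expresses [T] through
   its restrictions; otherwise that coefficient is a shorter identity. *)
Lemma rank_le_of_identity (c : Sg -> F) :
  (exists sigma, c sigma != 0) -> (forall sigma, c sigma != 0 -> normalized D i0 sigma) ->
  identity_for c T -> prank_le D #|{: Sg}| T.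
Proof.
move=> nz nrm idT.
(* [B] is the set of remaining factors. Families in the support of [d] agree outside [B], so for [B]
   empty a single term survives, contradicting the identity. *)
suff main m (B : {set 'I_N}) (d : Sg -> F) : (#|B| <= m)%N ->
    (exists sigma, d sigma != 0) ->
    (forall sigma, d sigma != 0 -> normalized D i0 sigma) ->
    (forall s t i a, d s != 0 -> d t != 0 -> a \notin B -> s i a = t i a) ->
    (forall X, \sum_sigma d sigma * \prod_(a in B) T (select X sigma a) = 0) ->
    prank_le D #|{: Sg}| T.
  apply: (main #|[set: 'I_N]| setT c) => // [s t i a _ _|X]; first by rewrite inE.
  rewrite -[RHS](idT X); apply: eq_bigr => s _; congr (_ * _).
  by apply: eq_bigl => a; rewrite inE.
elim: m B d => [|m IH] B d cB [s1 ds1] nrmd agr idB.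
  have B0 : B = set0 by apply/eqP; rewrite -cards_eq0 -leqn0.
  have := idB 0; rewrite (bigD1 s1) //= B0 big_set0 mulr1 big1 ?addr0 => [/eqP|s ss1].
    by rewrite (negPf ds1).
  apply/eqP; rewrite mulf_eq0; apply/orP; left; apply/negPn/negP => ds.
  case/eqP: ss1; apply/ffunP => i; apply/permP => a; apply: agr => //.
  by rewrite B0 inE.
have [B0|[a aB]] := set_0Vmem B; first by apply: (IH B d) => //; [rewrite B0 cards0|exists s1].
pose al i := s1 i a; pose M (s : Sg) := [forall i, s i a == al i].
pose d' s := if M s then d s else 0.
have Ms1 : M s1 by apply/forallP.
have d'P s : d' s != 0 -> M s /\ d s != 0.
  by rewrite /d'; case: ifP => //; rewrite eqxx.
have [/forallP id'|/forallPn[X0 k0]] :=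
  boolP [forall X : {ffun I * 'I_N -> V}, \sum_s d' s * \prod_(b in B :\ a) T (select X s b) == 0].
  apply: (IH (B :\ a) d') => [||s /d'P[_ /nrmd] //|s t i b|X]; last exact/eqP.
  - by move: cB; rewrite (cardsD1 a) aB.
  - by exists s1; rewrite /d' Ms1.
  move=> /d'P[/forallP Ms ds] /d'P[/forallP Mt dt].
  rewrite !inE negb_and negbK => /orP[/eqP ->|]; last exact: agr.
  by rewrite (eqP (Ms i)) (eqP (Mt i)).
set k := \sum_s _ in k0.
pose Xy (y : {ffun I -> V}) : {ffun I * 'I_N -> V} :=
  [ffun ib => if ib.2 == al ib.1 then y ib.1 else X0 ib].
pose Z (y : {ffun I -> V}) s :=
  (- k^-1 * d s * T (select (Xy y) s a)) * \prod_(b in B :\ a) T (select (Xy y) s b).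
(* Only the vectors [X (i, al i)] vary, the others being frozen at [X0]. If [M s] holds they all
   occur in the factor [a], so these terms add up to [k * T y]. *)
have TE y : T y = \sum_(s | ~~ M s) Z y s.
  have := idB (Xy y); rewrite (bigID M) /=.
  have -> : \sum_(s | M s) d s * \prod_(b in B) T (select (Xy y) s b) = k * T y.
    rewrite /k mulr_suml big_mkcond; apply: eq_bigr => s _; rewrite /d'.
    case: ifP => [/forallP Ms|_]; last by rewrite !mul0r.
    have -> : \prod_(b in B :\ a) T (select X0 s b) =
        \prod_(b in B | b != a) T (select (Xy y) s b).
      apply: eq_big => b; first by rewrite !inE andbC.
      rewrite !inE => /andP[ba _]; congr T; apply/ffunP => i; rewrite !ffunE /=.
      case: eqP => // eb; case/eqP: ba; apply: (@perm_inj _ (s i)).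
      by rewrite eb (eqP (Ms i)).
    have -> : T y = T (select (Xy y) s a).
      by congr T; apply/ffunP => i; rewrite !ffunE /= Ms.
    by rewrite (bigD1 a aB) /=; ring.
  have -> : \sum_(s | ~~ M s) d s * \prod_(b in B) T (select (Xy y) s b) =
      - k * \sum_(s | ~~ M s) Z y s.
    rewrite mulr_sumr; apply: eq_bigr => s _; rewrite (bigD1 a aB) /= /Z !mulrA.
    rewrite mulrNN divff // mul1r; congr (_ * _).
    by apply: eq_bigl => b; rewrite !inE andbC.
  by rewrite mulNr => /eqP; rewrite subr_eq0 => /eqP/(mulfI k0).
apply: prank_ext (fsym TE) _; apply: (prank_sum (F := fun s y => Z y s)) => s nM.
have [ds0|ds] := eqVneq (d s) 0.
  by apply: prank_zero => y; rewrite /Z ds0 mulr0 !mul0r.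
(* [J] contains [i0], where normalized families agree, and omits a direction of [D] because [M s]
   fails. *)
pose J := [set i | s i a == al i].
apply: (@prank_mul _ _ _ _ (D :&: J)).
- apply/set0Pn; exists i0; rewrite !inE i0D /= /al.
  by rewrite (nrmd _ ds).1 (nrmd _ ds1).1.
- rewrite properE subsetIl /=; apply/subsetPn.
  case/forallPn: nM => i hi; exists i; last by rewrite !inE negb_and hi orbT.
  apply/negPn/negP => iD; case/negP: hi.
  by rewrite /al (nrmd _ ds).2 // (nrmd _ ds1).2.
- apply: mlin_scale; apply: mlin_ext (mlin_merge J [ffun i => X0 (i, s i a)]) => y.
  by congr T; apply/ffunP => i; rewrite !ffunE inE.
rewrite setDIr setDv set0U; apply: mlin_select_prod => [|i ia]; first by rewrite !inE eqxx.
rewrite !inE; apply/andP; split.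
  by apply: contra ia => /eqP <-; rewrite permKV.
apply/negPn/negP => nB; have := agr _ _ i _ ds ds1 nB; rewrite permKV => /perm_inj ab.
by rewrite -ab aB in nB.
Qed.

End IdentityToRank.

(** Inserting or removing a fixed [b] outside [S] pairs the supersets with opposite signs. *)
Lemma sum_signed_supersets (R : comNzRingType) (T : finType) (S : {set T}) :
  S != setT -> \sum_(B : {set T} | S \subset B) (-1) ^+ #|~: B| = 0 :> R.
Proof.
rewrite -subTset => /subsetPn[b _ bS].
rewrite (bigID (fun B : {set T} => b \in B)) /=.
rewrite (reindex_onto (fun B => b |: B) (fun B => B :\ b)) /=; last first.
  by move=> B /andP[_ bB]; rewrite setD1K.
apply/eqP; rewrite addr_eq0 -sumrN; apply/eqP; apply: eq_big => B.
  rewrite !inE eqxx andbT; apply/andP/andP => -[h1 h2]; split.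
  - apply/subsetP => x xS; have := subsetP h1 x xS; rewrite !inE => /orP[/eqP xb|//].
    by rewrite -xb xS in bS.
  - by rewrite -(eqP h2) !inE eqxx.
  - exact: subset_trans h1 (subsetUr _ _).
  - by rewrite setU1K.
case/andP=> _ /eqP eB; have bB : b \in ~: B by rewrite -eB !inE eqxx.
have -> : ~: (b |: B) = ~: B :\ b by rewrite setCU setIC setDE.
by rewrite (cardsD1 b (~: B)) bB exprS mulN1r opprK.
Qed.

(* Ryser's formula for the permanent. *)
Lemma permanent_inclusion_exclusion (R : comNzRingType) (N : nat) (M : 'I_N -> 'I_N -> R) :
  \sum_(t : {perm 'I_N}) \prod_a M a (t a) =
  \sum_(B : {set 'I_N}) (-1) ^+ #|~: B| * \prod_a \sum_(b in B) M a b.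
Proof.
transitivity (\sum_(f : {ffun 'I_N -> 'I_N}) \sum_(B : {set 'I_N} | f @: setT \subset B)
    (-1) ^+ #|~: B| * \prod_a M a (f a)); last first.
  rewrite (exchange_big_dep xpredT) //=; apply: eq_bigr => B _.
  rewrite bigA_distr_big big_distrr /=; apply: eq_bigl => f.
  apply/subsetP/ffun_onP => [h a|h b /imsetP[a _ ->] //].
  by apply: h; apply: imset_f.
rewrite [RHS](bigID (fun f : {ffun 'I_N -> 'I_N} => injectiveb f)) /=.
rewrite [X in _ = _ + X]big1 ?addr0 => [|f nf]; last first.
  rewrite -big_distrl /= sum_signed_supersets ?mul0r //; apply: contra nf => /eqP fT.
  have : {in [set: 'I_N] &, injective f} by apply/imset_injP; rewrite fT.
  by move=> inj; apply/injectiveP => x y; apply: inj; rewrite inE.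
rewrite [RHS](reindex (@pval _)) /=; last first.
  pose in_Sn := insubd (1%g : {perm 'I_N}).
  by exists in_Sn => /= f Uf; first apply: val_inj; apply: insubdK.
apply: eq_big => /= [s|s _]; first by rewrite (valP s).
rewrite (big_pred1 setT) => [|B]; last first.
  have -> : pval s @: setT = setT.
    apply/setP => b; rewrite inE; apply/imsetP; exists (s^-1 b)%g => //.
    by rewrite pvalE permKV.
  by rewrite subTset.
by rewrite setCT cards0 mul1r; apply: eq_bigr => a _; rewrite pvalE.
Qed.

(** Evaluate the identity of the slices at [v = \sum_(b in B) X (i, b)] and sum over [B] with signs:
    Ryser's formula replaces the common vector by all arrangements of the [X (i, b)]. Hence the new
    coefficient ignores [s i]. *)
Lemma identity_polarize (I : finType) (F : finFieldType) (n N : nat) (D : {set I})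
    (i0 i : I) (T : {ffun I -> 'rV[F]_n} -> F) (c : {ffun I -> {perm 'I_N}} -> F) :
  mlin D T -> i \in D -> (forall s, c s != 0 -> normalized (D :\ i) i0 s) ->
  (forall v, identity_for c (fun x => T (upd x i v))) ->
  identity_for (fun s => c (upd s i 1%g)) T.
Proof.
move=> mT iD nrm idT X.
rewrite (partition_big (fun s => upd s i 1%g) (fun s => s i == 1%g)) => [|s _]; last first.
  by rewrite ffunE eqxx.
have E (s : {ffun I -> {perm 'I_N}}) : s i == 1%g ->
   \sum_(s' | true && (upd s' i 1%g == s)) c (upd s' i 1%g) * \prod_a T (select X s' a) =
   \sum_(B : {set 'I_N}) (-1) ^+ #|~: B| *
     (c s * \prod_a T (upd (select X s a) i (\sum_(b in B) X (i, b)))).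
  move=> /eqP s1; rewrite /=.
  rewrite (reindex_onto (fun t => upd s i t) (fun s' : {ffun I -> {perm 'I_N}} => s' i)) /=; last first.
    move=> s' /eqP <-; apply/ffunP => k; rewrite !ffunE; case: eqP => [->|//].
    by [].
  have us t : upd (upd s i t) i 1%g = s.
    by apply/ffunP => k; rewrite !ffunE; case: eqP => [->|//]; rewrite s1.
  transitivity (c s * \sum_(t : {perm 'I_N}) \prod_a T (upd (select X s a) i (X (i, t a)))).
    rewrite mulr_sumr; apply: eq_big => t; first by rewrite us eqxx ffunE !eqxx.
    move=> _; rewrite us; congr (_ * _); apply: eq_bigr => a _; congr T.
    by apply/ffunP => k; rewrite !ffunE; case: (k =P i) => [->|].
  rewrite (permanent_inclusion_exclusion (fun a b => T (upd (select X s a) i (X (i, b))))).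
  rewrite mulr_sumr; apply: eq_bigr => B _; rewrite mulrCA; congr (_ * (_ * _)).
  by apply: eq_bigr => a _; rewrite (mlin_upd_sum _ _ _ _ mT iD).
rewrite (eq_bigr _ E) exchange_big /= big1 // => B _.
rewrite -mulr_sumr; apply/eqP; rewrite mulf_eq0; apply/orP; right; apply/eqP.
rewrite -[RHS](idT (\sum_(b in B) X (i, b)) X).
rewrite [RHS](bigID (fun s : {ffun I -> {perm 'I_N}} => s i == 1%g)) /=.
rewrite [X in _ = _ + X]big1 ?addr0 // => s ns.
have [->|/nrm[_ h]] := eqVneq (c s) 0; first by rewrite mul0r.
by move: ns; rewrite h ?eqxx // !inE eqxx.
Qed.

(** * Sumsets of cones *)

Section Sumsets.
Variables (F : finFieldType) (n : nat).
Local Notation V := 'rV[F]_n.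

Definition sumset (A B : {set V}) : {set V} := [set ab.1 + ab.2 | ab in setX A B].

Lemma sumsetP (A B : {set V}) (v : V) :
  reflect (exists a b, [/\ a \in A, b \in B & v = a + b]) (v \in sumset A B).
Proof.
apply: (iffP imsetP) => [[[a b] /setXP[aA bB] ->]|[a [b [aA bB ->]]]].
  by exists a, b.
by exists (a, b) => //; apply/setXP.
Qed.

Definition cone (A : {set V}) := 0 \in A /\ forall a v, v \in A -> a *: v \in A.

Lemma cone_sumset (A B : {set V}) : cone A -> cone B -> cone (sumset A B).
Proof.
move=> [A0 Aa] [B0 Ba]; split=> [|a v /sumsetP[x [y [xA yB ->]]]]; apply/sumsetP.
  by exists 0, 0; rewrite addr0.
by exists (a *: x), (a *: y); rewrite scalerDr; split=> //; [apply: Aa|apply: Ba].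
Qed.

Definition sum5 (A : {set V}) := sumset (sumset (sumset A A) (sumset A A)) A.

(* If [5Y] is less than [q] times as large as [Y] then, for [v] in [4Y], the map
   [(t, y) |-> y + t v] is not injective on [F * Y], whence [v] is in [2Y]. *)
Lemma sumset_closed (Y : {set V}) : cone Y -> (#|sum5 Y| < #|F| * #|Y|)%N ->
  forall u v, u \in sumset Y Y -> v \in sumset Y Y -> u + v \in sumset Y Y.
Proof.
move=> [Y0 Ya] small u v uY vY; set w := u + v.
have wY : w \in sumset (sumset Y Y) (sumset Y Y) by apply/sumsetP; exists u, v.
have [_ wa] := cone_sumset (cone_sumset (conj Y0 Ya) (conj Y0 Ya)) (cone_sumset (conj Y0 Ya) (conj Y0 Ya)).
pose f (ty : F * V) := ty.1 *: w + ty.2.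
have : ~~ [forall x in setX setT Y, forall y in setX setT Y, (f x == f y) ==> (x == y)].
  apply/negP => /forall_inP h.
  have inj : {in setX setT Y &, injective f}.
    by move=> x y xY yY fxy; apply/eqP; have /forall_inP/(_ y yY)/implyP := h x xY; apply; rewrite fxy.
  move: small; rewrite ltnNge => /negP; apply.
  rewrite -cardsT -cardsX -(card_in_imset inj); apply: subset_leq_card.
  apply/subsetP => _ /imsetP[[t y] /setXP[_ yY] ->]; apply/sumsetP.
  by exists (t *: w), y; split=> //; apply: wa.
rewrite negb_forall_in => /exists_inP[[t y] /setXP[_ yY]].
rewrite negb_forall_in => /exists_inP[[t' y'] /setXP[_ yY']].
rewrite negb_imply /f /= => /andP[/eqP e ne].
have tt : t - t' != 0.
  rewrite subr_eq0; apply: contra ne => /eqP tt; move: e; rewrite tt => /addrI ->.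
  by rewrite eqxx.
apply/sumsetP; exists ((t - t')^-1 *: y'), (- (t - t')^-1 *: y); split; try exact: Ya.
rewrite scaleNr -scalerBr.
have -> : y' - y = (t - t') *: w.
  by rewrite scalerBl; apply/eqP; rewrite subr_eq addrAC eq_sym subr_eq e addrC.
by rewrite scalerA mulVf // scale1r.
Qed.

(** Each [sum5] multiplies the size by at least [#|F|] until [sumset_closed] applies, and the
    density of [X] leaves room for at most [m] such steps. [P a v] reads as a cost [a] for [v]:
    times 5 per step, doubled at the end. *)
Lemma exists_subspace_in_sumset (m : nat) (P : nat -> V -> Prop) (r : nat) (X : {set V}) :
  cone X -> (#|V| <= #|X| * #|F| ^ m)%N ->
  (forall a b u v, P a u -> P b v -> P (a + b)%N (u + v)) ->
  (forall a b v, (a <= b)%N -> P a v -> P b v) -> (forall v, v \in X -> P r v) ->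
  exists W : {set V}, [/\ 0 \in W, forall a u v, u \in W -> v \in W -> a *: u + v \in W,
    (#|V| <= #|W| * #|F| ^ m)%N & forall v, v \in W -> P (2 * (5 ^ m * r))%N v].
Proof.
move=> cX bigX PD Pm PX; pose Y k := iter k sum5 X.
have cY k : cone (Y k).
  elim: k => //= k IH; do !apply: cone_sumset => //.
have subS (A B : {set V}) : cone B -> A \subset sumset A B.
  by move=> [B0 _]; apply/subsetP => a aA; apply/sumsetP; exists a, 0; rewrite addr0.
have XY k : X \subset Y k.
  elim: k => //= k IH; apply: subset_trans IH _.
  apply: subset_trans (subS _ _ (cY k)) _; apply: subset_trans (subS _ _ (cone_sumset (cY k) (cY k))) _.
  exact: subS.
have PY k v : v \in Y k -> P (5 ^ k * r)%N v.
  elim: k v => [|k IH] v /=; first by rewrite mul1n; apply: PX.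
  case/sumsetP=> _ [e [/sumsetP[_ [_ [/sumsetP[a [b [aY bY ->]]] /sumsetP[c [d [cY' dY ->]]] ->]]] eY ->]].
  have -> : (5 ^ k.+1 * r = ((5 ^ k * r + 5 ^ k * r) + (5 ^ k * r + 5 ^ k * r)) + 5 ^ k * r)%N.
    by rewrite expnS; ring.
  exact: (PD _ _ _ _ (PD _ _ _ _ (PD _ _ _ _ (IH _ aY) (IH _ bY)) (PD _ _ _ _ (IH _ cY') (IH _ dY))) (IH _ eY)).
have F1 : (1 < #|F|)%N by apply: finNzRing_gt1.
have [k km small] : exists2 k, (k <= m)%N & (#|sum5 (Y k)| < #|F| * #|Y k|)%N.
  case: (boolP [exists k : 'I_m.+1, (#|sum5 (Y k)| < #|F| * #|Y k|)%N]).
    by case/existsP=> k hk; exists k => //; rewrite -ltnS.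
  move/existsPn => h.
  have gr k : (k <= m.+1)%N -> (#|F| ^ k * #|X| <= #|Y k|)%N.
    elim: k => [|k IH] km; first by rewrite mul1n.
    have := h (Ordinal km); rewrite -leqNgt /=; apply: leq_trans.
    by rewrite expnS -mulnA leq_mul2l IH ?orbT // ltnW.
  have := gr m.+1 (leqnn _); rewrite expnS -mulnA [(_ ^ m * _)%N]mulnC => h2.
  have := leq_trans (leq_mul (leqnn _) bigX) (leq_trans h2 (max_card _)).
  have V0 : (0 < #|V|)%N by apply/card_gt0P; exists 0.
  by rewrite -[X in (_ <= X)%N]mul1n leq_pmul2r // leqNgt F1.
have [W0 Wa] := cone_sumset (cY k) (cY k).
exists (sumset (Y k) (Y k)); split=> [//|a u v uW vW||v].
- by apply: sumset_closed => //; apply: Wa.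
- apply: leq_trans bigX _; rewrite leq_mul2r; apply/orP; right; apply: subset_leq_card.
  by apply: subset_trans (XY k) _; apply: subS.
case/sumsetP=> a [b [aY bY ->]]; apply: Pm (PD _ _ _ _ (PY k a aY) (PY k b bY)).
by rewrite addnn -mul2n leq_mul2l leq_mul2r leq_exp2l // km !orbT.
Qed.

Lemma exists_projector (m : nat) (W : {set V}) :
  0 \in W -> (forall a u v, u \in W -> v \in W -> a *: u + v \in W) ->
  (#|V| <= #|W| * #|F| ^ m)%N ->
  exists (m' : nat) (pr : V -> V) (l : 'I_m' -> V -> F) (e : 'I_m' -> V),
  (m' <= m)%N /\
  [/\ forall a u v, pr (a *: u + v) = a *: pr u + pr v, forall v, pr v \in W,
      forall k a u v, l k (a *: u + v) = a * l k u + l k v &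
      forall v, v = pr v + \sum_k l k v *: e k].
Proof.
move=> W0 Wa bigW; pose U := <<enum W>>%VS; pose C := (U^C)%VS.
have WZ a v : v \in W -> a *: v \in W by move=> vW; rewrite -[a *: v]addr0; apply: Wa.
have WD u v : u \in W -> v \in W -> u + v \in W.
  by move=> uW vW; rewrite -[u]scale1r; apply: Wa.
have UW v : v \in U -> v \in W.
  move=> vU; have := @coord_span _ _ _ (in_tuple (enum W)) v vU => ->.
  elim/big_ind: _ => // i _; apply: WZ.
  by rewrite -mem_enum; apply: mem_nth.
have WU v : v \in W -> v \in U by move=> vW; apply: memv_span; rewrite mem_enum.
have cW : (#|W| <= #|F| ^ \dim U)%N.
  pose f (c : 'rV[F]_(\dim U)) := \sum_i c 0 i *: (vbasis U)`_i.
  rewrite -[X in (_ ^ X)%N]mul1n -card_mx -[#|'rV_ _|](cardsT 'rV[F]_(\dim U)).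
  apply: leq_trans (leq_imset_card f _); apply: subset_leq_card.
  apply/subsetP => v /WU vU; apply/imsetP; exists (\row_i coord (vbasis U) i v) => //.
  by rewrite {1}(coord_vbasis vU); apply: eq_bigr => i _; rewrite mxE.
have dV : \dim {: V} = n by rewrite dimvf /dim /= mul1n.
have dC : (\dim C <= m)%N.
  rewrite dimv_compl dV leq_subLR -(leq_exp2l (m := #|F|)) ?finNzRing_gt1 //.
  rewrite expnD -[X in (_ ^ X <= _)%N]mul1n -card_mx.
  by apply: leq_trans bigW _; rewrite leq_mul2r cW orbT.
exists (\dim C), (projv U), (fun k v => coord (vbasis C) k (v - projv U v)),
  (fun k => (vbasis C)`_k); split=> //; split=> [a u v|v|k a u v|v].
- by rewrite linearP.
- by apply/UW/memv_proj.
- rewrite -[RHS](linearP (coord (vbasis C) k)); congr (coord _ _ _).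
  by rewrite linearP scalerBr opprD addrACA.
by rewrite -(coord_vbasis (memv_projC U v)) addrC subrK.
Qed.

End Sumsets.

(** * Universal identities for forms of bounded rank *)

Lemma bin_le_exp2 n k : ('C(n, k) <= 2 ^ n)%N.
Proof.
elim: n k => [|n IH] [|k]; rewrite ?bin0 ?expn_gt0 ?bin0n //.
by rewrite binS expnS mul2n -addnn leq_add.
Qed.

Lemma expn_le_ffact m n : (m ^ n <= (m + n) ^_ n)%N.
Proof.
elim: n => [|n IH]; first by rewrite ffactn0.
by rewrite addnS ffactSS expnS leq_mul // leqW // leq_addr.
Qed.

Lemma expnn_le_fact n : (n ^ n <= 4 ^ n * n`!)%N.
Proof.
apply: leq_trans (expn_le_ffact n n) _; rewrite -bin_ffact leq_mul2r.
by rewrite (_ : 4 = 2 ^ 2)%N // -expnM mul2n -addnn bin_le_exp2 orbT.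
Qed.

(** Up to a factor [4 ^ N] each factorial is at least [N ^ N], so the right side has one power
    [N ^ N] to spare, which beats [(C * 4 ^ k.+1) ^ N]. *)
Lemma exists_fact_gt (C k : nat) :
  exists N : nat, (C ^ N * (N ^ k) ^ N < N`! ^ k.+1)%N.
Proof.
pose N := (C * 4 ^ k.+1).+1%N; exists N.
have h : ((4 ^ k.+1) ^ N * (C ^ N * (N ^ k) ^ N) < (4 ^ k.+1) ^ N * N`! ^ k.+1)%N.
  apply: (@leq_trans (N ^ N * (N ^ k) ^ N)%N).
    rewrite mulnA -expnMn ltn_pmul2r ?expn_gt0 // ltn_exp2r //.
    by rewrite mulnC.
  have -> : (N ^ N * (N ^ k) ^ N = (N ^ N) ^ k.+1)%N.
    by rewrite -expnMn -expnS -!expnM mulnC.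
  have -> : ((4 ^ k.+1) ^ N = (4 ^ N) ^ k.+1)%N by rewrite -!expnM mulnC.
  by rewrite -expnMn leq_exp2r // expnn_le_fact.
by move: h; rewrite ltn_pmul2l // expn_gt0 expn_gt0.
Qed.

Lemma exists_left_kernel (F : fieldType) (S P : finType) (A : {set S}) (M : S -> P -> F) :
  (#|P| < #|A|)%N ->
  exists c : S -> F, [/\ exists s, c s != 0, forall s, s \notin A -> c s = 0 &
    forall p, \sum_s c s * M s p = 0].
Proof.
move=> PA; pose MM := \matrix_(i < #|A|, j < #|P|) M (enum_val i) (enum_val j).
have : kermx MM != 0.
  rewrite kermx_eq0 /row_free; apply: contraTN PA => /eqP <-.
  by rewrite -leqNgt rank_leq_col.
case/rowV0Pn=> u /sub_kermxP uM u0.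
pose c s := \sum_i u 0 i *+ (enum_val i == s).
have cE i : c (enum_val i) = u 0 i.
  rewrite /c (bigD1 i) //= eqxx mulr1n big1 ?addr0 // => j ji.
  by rewrite (inj_eq enum_val_inj) (negPf ji).
exists c; split.
- have [i ui] : exists i, u 0 i != 0.
    apply/existsP; apply: contraR u0 => /existsPn h; apply/eqP/rowP => i.
    by rewrite mxE; apply/eqP; move: (h i); rewrite negbK.
  by exists (enum_val i); rewrite cE.
- move=> s sA; rewrite /c big1 // => i _; case: eqP => // e.
  by move: (enum_valP i); rewrite e (negPf sA).
move=> p; have := congr1 (fun w : 'rV_ _ => w 0 (enum_rank p)) uM; rewrite !mxE => uMp; rewrite -[RHS]uMp.
rewrite (eq_bigr (fun s => \sum_i u 0 i *+ (enum_val i == s) * M s p)) => [|s _]; last first.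
  by rewrite -mulr_suml.
rewrite exchange_big /=; apply: eq_bigr => i _.
rewrite mxE enum_rankK (bigD1 (enum_val i)) //= eqxx mulr1n big1 ?addr0 // => s si.
by rewrite eq_sym (negPf si) mul0r.
Qed.

(** * Encoding the monomials of forms of bounded rank by colourings *)

Section Colors.
Variables (I : finType) (F : finFieldType) (D : {set I}) (i0 : I) (R : nat).
Hypothesis i0D : i0 \in D.
Local Notation K := ({set I} * 'I_R)%type.

Definition proper_part (J : {set I}) := (i0 \in J) && (J \proper D).

(** All forms of rank at most [R] are expanded over one finite set of colours. Exchanging [Q] and
    [G] puts the factor that reads [i0] first; the last clause keeps a colour free for the next step
    of the induction. *)
Lemma prank_colors (n r : nat) (T : {ffun I -> 'rV[F]_n} -> F) :
  prank_le D r T -> (r <= R)%N ->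
  exists Q G : K -> {ffun I -> 'rV[F]_n} -> F,
  [/\ forall x, T x = \sum_k Q k x * G k x,
      forall k : K, proper_part k.1 -> mlin k.1 (Q k) /\ mlin (D :\: k.1) (G k),
      forall (k : K) x, ~~ proper_part k.1 -> Q k x = 0 &
      forall (k : K) x, (r <= k.2)%N -> Q k x = 0].
Proof.
elim=> {r T} [r T T0 _|r J Q G T T' J0 JD mQ mG _ IH eT rR].
  exists (fun _ _ => 0), (fun _ _ => 0); split=> // [x|k _].
    by rewrite T0 big1 // => k _; rewrite mul0r.
  by split; apply: mlin0.
have [Q' [G' [eT' mQG' Q0' Q0r]]] := IH (ltnW rR).
have [J1 [Q1 [G1 [pJ1 mQ1 mG1 e1]]]] : exists J1 Q1 G1,
    [/\ proper_part J1, mlin J1 Q1, mlin (D :\: J1) G1 & forall x, Q x * G x = Q1 x * G1 x].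
  have [iJ|iJ] := boolP (i0 \in J); first by exists J, Q, G; rewrite /proper_part iJ.
  exists (D :\: J), G, Q; split=> // [||x]; last exact: mulrC.
    rewrite /proper_part !inE iJ i0D /= properEneq subDset subsetUr andbT.
    case/set0Pn: J0 => j jJ; apply/eqP => /setP/(_ j).
    by rewrite inE jJ (subsetP (proper_sub JD) _ jJ).
  by rewrite setDDr setDv set0U (setIidPr (proper_sub JD)).
pose k1 : K := (J1, Ordinal rR).
exists (fun k => if k == k1 then Q1 else Q' k), (fun k => if k == k1 then G1 else G' k).
split=> [x|k pk|k x pk|k x rk].
- rewrite eT e1 (bigD1 k1) //= eqxx eT' (bigD1 k1) //= Q0r // mul0r add0r.
  by congr (_ + _); apply: eq_bigr => k /negPf ->.
- by case: eqP => [->|_]; [split|apply: mQG'].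
- case: eqP pk => [->|_]; [by rewrite pJ1|exact: Q0'].
case: eqP rk => [->|_ rk]; first by rewrite ltnn.
by apply: Q0r; apply: ltnW.
Qed.

Section Pattern.
Variables (N k : nat).
Hypothesis cD : #|D| = k.+2.
Local Notation Sg := {ffun I -> {perm 'I_N}}.

Definition other (J : {set I}) : I := odflt i0 [pick i in D :\: J].

Lemma other_in (J : {set I}) : proper_part J -> other J \in D :\: J.
Proof.
case/andP=> _; rewrite properE => /andP[_ /subsetPn[i iD iJ]]; rewrite /other.
by case: pickP => [//|/(_ i)]; rewrite !inE iD iJ.
Qed.

Definition rest (J : {set I}) : seq I := enum (D :\: [set i0; other J]).

Lemma size_rest (J : {set I}) : proper_part J -> size (rest J) = k.
Proof.
move=> pJ; have := other_in pJ; rewrite inE => /andP[oJ oD].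
rewrite -cardE cardsD cD (setIidPr _); last by apply/subsetP => i /set2P[]->.
rewrite cards2; have -> : i0 != other J; last by rewrite subSS subSS subn0.
by apply: contraNneq oJ => <-; case/andP: pJ.
Qed.

(** A colouring of the indices, one image set per colour for the direction [other], and [k] values
    per index for the directions in [rest]. *)
Definition pattern :=
  ({ffun 'I_N -> K} * {ffun K -> {set 'I_N}} * {ffun 'I_N -> k.-tuple 'I_N})%type.

Definition fiber (f : {ffun 'I_N -> K}) (c : K) := [set a | f a == c].

(** The [j]-th element of a fibre goes to the [j]-th element of the set attached to its colour, so
    the set alone determines the map. *)
Definition transport (f : {ffun 'I_N -> K}) (B : {ffun K -> {set 'I_N}}) (a : 'I_N) : 'I_N :=
  nth a (enum (B (f a))) (index a (enum (fiber f (f a)))).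

Definition decode (p : pattern) (i : I) (a : 'I_N) : 'I_N :=
  if i == i0 then a else
  if i == other (p.1.1 a).1 then transport p.1.1 p.1.2 a else
  nth a (p.2 a) (index i (rest (p.1.1 a).1)).

Definition images (s : Sg) (f : {ffun 'I_N -> K}) : {ffun K -> {set 'I_N}} :=
  [ffun c : K => s (other c.1) @: fiber f c].

(* In a product over [a] of values of the right-hand factors, indices of the same
   colour may be permuted; [shuffle] is the permutation after which the values of [s]
   in the direction [other] are determined by their image set alone.  This saves one
   of the [k + 1] permutations, up to exponentially many choices. *)
Definition shuffle (s : Sg) (f : {ffun 'I_N -> K}) (a : 'I_N) : 'I_N :=
  (s (other (f a).1))^-1%g (transport f (images s f) a).

Definition encode (s : Sg) (f : {ffun 'I_N -> K}) : pattern :=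
  (f, images s f,
   [ffun a => [tuple (let i := nth i0 (rest (f a).1) j in
                      if i \in (f a).1 then s i a else s i (shuffle s f a)) | j < k]]).

Lemma transport_in (s : Sg) (f : {ffun 'I_N -> K}) a : transport f (images s f) a \in images s f (f a).
Proof.
rewrite -mem_enum; apply: mem_nth; rewrite -cardE ffunE card_imset; last exact: perm_inj.
by rewrite cardE index_mem mem_enum inE.
Qed.

Lemma shuffle_color (s : Sg) (f : {ffun 'I_N -> K}) a : f (shuffle s f a) = f a.
Proof.
have := transport_in s f a; rewrite ffunE => /imsetP[b]; rewrite inE => /eqP fb e.
by rewrite /shuffle e permK.
Qed.

Lemma shuffle_inj (s : Sg) (f : {ffun 'I_N -> K}) : injective (shuffle s f).
Proof.
move=> a b e; have fab : f a = f b by rewrite -(shuffle_color s f a) e shuffle_color.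
move: e; rewrite /shuffle fab => /perm_inj; rewrite /transport fab.
have lt c : f c = f b -> (index c (enum (fiber f (f b))) < size (enum (images s f (f b))))%N.
  move=> fc; rewrite -cardE ffunE card_imset; last exact: perm_inj.
  by rewrite cardE index_mem mem_enum inE fc.
rewrite (set_nth_default b) ?lt // => /eqP; rewrite nth_uniq ?enum_uniq ?lt //.
by move=> /eqP /(index_inj a); apply; rewrite mem_enum inE ?fab.
Qed.

(** Left factors read only the directions of [J], where [decode] returns [s i a]. The product of the
    right factors is reindexed by [shuffle], which preserves colours; the direction [other] then
    takes the value given by [transport]. *)
Lemma prod_encode (n : nat) (Q G : K -> {ffun I -> 'rV[F]_n} -> F)
    (X : {ffun I * 'I_N -> 'rV[F]_n}) (s : Sg) (f : {ffun 'I_N -> K}) :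
  (forall c : K, proper_part c.1 -> mlin c.1 (Q c) /\ mlin (D :\: c.1) (G c)) ->
  normalized D i0 s -> (forall a, proper_part (f a).1) ->
  let y a : {ffun I -> 'rV[F]_n} := [ffun i => X (i, decode (encode s f) i a)] in
  \prod_a (Q (f a) (select X s a) * G (f a) (select X s a)) =
  \prod_a (Q (f a) (y a) * G (f a) (y a)).
Proof.
move=> mQG [s0 _] pf y; rewrite !big_split /=; congr (_ * _).
  apply: eq_bigr => a _; apply: (mQG _ (pf a)).1.1 => i iJ.
  have iD : i \in D by apply: subsetP (proper_sub _) _ iJ; case/andP: (pf a).
  rewrite !ffunE /decode /=; case: (i =P i0) => [->|/eqP ii0]; first by rewrite s0 perm1.
  have io : i != other (f a).1.
    by apply: contraTneq (other_in (pf a)) => <-; rewrite inE iJ.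
  rewrite (negPf io).
  have ir : i \in rest (f a).1 by rewrite mem_enum !inE negb_or ii0 io.
  have lt : (index i (rest (f a).1) < k)%N by rewrite -(size_rest (pf a)) index_mem.
  by rewrite ffunE (nth_mktuple _ a (Ordinal lt)) /= nth_index // iJ.
rewrite (reindex_inj (@shuffle_inj s f)); apply: eq_bigr => a _.
rewrite shuffle_color; apply: (mQG _ (pf a)).2.1 => i; rewrite inE => /andP[iJ iD].
rewrite !ffunE /decode /=.
have ii0 : i != i0 by apply: contraNneq iJ => ->; case/andP: (pf a).
rewrite (negPf ii0); case: (i =P _) => [->|/eqP io]; first by rewrite permKV.
have ir : i \in rest (f a).1 by rewrite mem_enum !inE negb_or ii0 io.
have lt : (index i (rest (f a).1) < k)%N by rewrite -(size_rest (pf a)) index_mem.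
by rewrite ffunE (nth_mktuple _ a (Ordinal lt)) /= nth_index // (negPf iJ).
Qed.

Lemma card_pattern : #|{: pattern}| = (#|{: K}| ^ N * (2 ^ #|{: K}|) ^ N * (N ^ k) ^ N)%N.
Proof.
have cset : #|{: {set 'I_N}}| = (2 ^ N)%N.
  by rewrite -cardsT -powersetT card_powerset cardsT card_ord.
rewrite card_prod card_prod !card_ffun card_tuple !card_ord cset.
by rewrite -!expnM [(N * #|_|)%N]mulnC.
Qed.

Definition normal_set : {set Sg} := [set s : Sg | (s i0 == 1%g) && [forall i, (i \notin D) ==> (s i == 1%g)]].

Lemma card_normal_set : #|normal_set| = (N`! ^ k.+1)%N.
Proof.
have cDi : #|D :\ i0| = k.+1 by move: cD; rewrite (cardsD1 i0) i0D => -[].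
rewrite -card_Sn -cDi -(card_pffun_on 1%g (mem (D :\ i0)) predT); apply: eq_card => s.
rewrite inE; apply/andP/pffun_onP => [[/eqP s0 /forallP sD]|[h _]].
  split=> //; apply/subsetP => i; apply: contraR; rewrite !inE negb_and negbK.
  by case/orP=> [/eqP ->|iD]; rewrite ?s0 //; have := sD i; rewrite iD.
have h1 i : i \notin D :\ i0 -> s i = 1%g.
  by move=> iD; apply/eqP; apply: contraR iD => si; apply: (subsetP h); rewrite inE.
split; first by rewrite h1 // !inE eqxx.
by apply/forallP => i; apply/implyP => iD; rewrite h1 // !inE negb_and iD orbT.
Qed.

End Pattern.

End Colors.

(* The number of monomials indexed by normalized families is [N!^(k-1)], while
   on forms of rank at most [R] each is a sum of terms taken from a set of at most
   [C^N N^(N(k-2))] functions; hence a linear relation for [N] large. *)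
Theorem exists_universal_identity (I : finType) (m R : nat) : exists N : nat,
  forall (F : finFieldType) (D : {set I}) (i0 : I), i0 \in D -> #|D| = m.+1 ->
  exists c : {ffun I -> {perm 'I_N}} -> F,
  [/\ exists s, c s != 0, forall s, c s != 0 -> normalized D i0 s &
    forall (n : nat) (T : {ffun I -> 'rV[F]_n} -> F), prank_le D R T -> identity_for c T].
Proof.
case: m => [|k].
  exists 1%N => F D i0 i0D cD; exists (fun s => (s == [ffun=> 1%g])%:R); split.
  - by exists [ffun=> 1%g]; rewrite /= eqxx oner_neq0.
  - move=> s /=; case: (s =P _) => [-> _|]; last by rewrite eqxx.
    by split=> [|i _]; rewrite ffunE.
  move=> n T h X; suff T0 x : T x = 0.
    by rewrite big1 // => s _; rewrite big_ord1 T0 mulr0.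
  case: h cD => [//|r J Q G S S' J0 /proper_card JD _ _ _ _] cD.
  by move: JD; rewrite cD ltnS leqn0 cards_eq0 (negPf J0).
(* Now [k] is the arity minus 2, and [C ^ N] counts colourings together with image sets. *)
pose C := (#|{: {set I} * 'I_R}| * 2 ^ #|{: {set I} * 'I_R}|)%N.
have [N hN] := exists_fact_gt C k.
exists N => F D i0 i0D cD.
pose good (f : {ffun 'I_N -> {set I} * 'I_R}) := [forall a, proper_part D i0 (f a).1].
pose M (s : {ffun I -> {perm 'I_N}}) (p : pattern I R N k) : F :=
  \sum_(f | good f) (encode D i0 k s f == p)%:R.
have [|c [cnz cout cM]] := exists_left_kernel (A := normal_set D i0 N) M.
  by rewrite (card_normal_set i0D N cD) card_pattern -expnMn.
exists c; split=> // [s|n T hT X].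
  move=> cs; have : s \in normal_set D i0 N by apply: contraR cs => /cout ->.
  rewrite inE => /andP[/eqP s0 /forallP h]; split=> // i iD; apply/eqP.
  by have := h i; rewrite iD.
have [Q [G [eT mQG Q0 _]]] := prank_colors i0D hT (leqnn _).
pose y (p : pattern I R N k) a : {ffun I -> 'rV[F]_n} := [ffun i => X (i, decode D i0 p i a)].
pose val (p : pattern I R N k) := \prod_a (Q (p.1.1 a) (y p a) * G (p.1.1 a) (y p a)).
(* The monomial of [s] is the combination of the [val p] with coefficients [M s p], and [M] involves
   neither [T] nor [X]. *)
transitivity (\sum_s \sum_p c s * M s p * val p); last first.
  rewrite exchange_big big1 //= => p _.
  by rewrite -mulr_suml cM mul0r.
apply: eq_bigr => s _.
have [sN|/cout ->] := boolP (s \in normal_set D i0 N); last first.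
  by rewrite mul0r big1 // => p _; rewrite !mul0r.
have nrm : normalized D i0 s.
  move: sN; rewrite inE => /andP[/eqP s0 /forallP h]; split=> // i iD; apply/eqP.
  by have := h i; rewrite iD.
under [RHS]eq_bigr => p _ do rewrite -mulrA.
rewrite -mulr_sumr; congr (_ * _).
under eq_bigr => a _ do rewrite eT.
rewrite bigA_distr_bigA /= (bigID good) /= [X in _ + X]big1 ?addr0 => [|f nf]; last first.
  case/forallPn: nf => a pa; rewrite (bigD1 a) //= Q0 //.
  by rewrite mul0r mul0r.
rewrite /M; under [RHS]eq_bigr => p _ do rewrite mulr_suml.
rewrite [RHS]exchange_big /=; apply: eq_bigr => f /forallP gf.
rewrite [RHS](bigD1 (encode D i0 k s f)) //= eqxx mul1r [X in _ = _ + X]big1 ?addr0 => [|p pf]; last first.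
  by rewrite eq_sym (negPf pf) mul0r.
exact: (prod_encode i0D cD).
Qed.

(** * From bias to rank over a finite field *)

Theorem rank_le_of_bias (I : finType) (m s : nat) : exists R : nat,
  forall (F : finFieldType) (n : nat) (D : {set I}) (T : {ffun I -> 'rV[F]_n} -> F)
    (chi : F -> algC),
  #|D| = m.+1 -> mlin D T -> add_char chi -> (exists a, chi a != 1) ->
  #|F|%:R^-1 ^+ s <= bias chi T -> prank_le D R T.
Proof.
elim: m s => [|m IH] s.
  exists 0%N => F n D T chi cD hT hchi [a chia] big.
  have [i Di] : exists i, D = [set i] by apply/cards1P; rewrite cD.
  rewrite Di in hT *; have iD : i \in [set i] by rewrite inE.
  have : 0 < bias chi T.
    by apply: lt_le_trans big; rewrite exprn_gt0 // invr_gt0 ltr0n ltnW // finNzRing_gt1.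
  rewrite (bias_linear hchi hT); case: forallP => [h _|]; last by rewrite ltxx.
  apply: prank_zero => x; apply/eqP; apply: contraNT chia => Tx.
  (* Rescaling the argument makes the form take the value [a], where [chi] is not 1. *)
  have := h ((a / T x) *: x i); rewrite (mlin_updZ _ _ _ hT iD).
  have -> : T (upd 0 i (x i)) = T x.
    by apply: hT.1 => k; rewrite inE => /eqP ->; rewrite updE eqxx.
  by rewrite divfK.
(* [R0] bounds the rank of slices of bias at least [q^-(s+1)], and [R1] that of slices along the
   subspace built from them. *)
have [R0 HR0] := IH s.+1; pose R1 := (2 * (5 ^ s.+1 * R0))%N.
have [N HN] := exists_universal_identity I m R1.
exists (#|{ffun I -> {perm 'I_N}}| + s.+1)%N => F n D T chi cD hT hchi nchi.
set q := #|F|; set Q : algC := q%:R^-1 => big.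
have q1 : (1 < q)%N by apply: finNzRing_gt1.
have qR : (0 : algC) < q%:R by rewrite ltr0n ltnW.
have Q0 : 0 < Q by rewrite invr_gt0.
have [i iD] : exists i, i \in D by apply/card_gt0P; rewrite cD.
set D' := D :\ i.
have cD' : #|D'| = m.+1 by move: cD; rewrite (cardsD1 i) iD => -[].
have [i0 i0D'] : exists i0, i0 \in D' by apply/card_gt0P; rewrite cD'.
have i0D : i0 \in D by move: i0D'; rewrite inE => /andP[].
pose Tv v := fun x => T (upd x i v).
have hTv v : mlin D' (Tv v) by apply: mlin_upd.
pose X0 := [set v | Q ^+ s.+1 <= bias chi (Tv v)].
pose X := [set v | [exists w in X0, [exists a, v == a *: w]]].
have X0X : X0 \subset X.
  apply/subsetP => w wX; rewrite [_ \in X]inE; apply/exists_inP; exists w => //.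
  by apply/existsP; exists 1; rewrite scale1r.
have V0 : (0 < #|{: 'rV[F]_n}|)%N by apply/card_gt0P; exists 0.
have bigX0 : (#|{: 'rV[F]_n}| <= #|X0| * q ^ s.+1)%N.
  have : #|{: 'rV[F]_n}|%:R * Q ^+ s.+1 <= #|X0|%:R.
    apply: avg_markov.
    - by move=> v; rewrite (bias_ge0 hchi (hTv v) i0D') (bias_le1 hchi (hTv v) i0D').
    - by rewrite exprn_ge0 // ltW.
    rewrite -bias_upd //; apply: le_trans big.
    rewrite exprS -mulrnAl -[leRHS]mul1r ler_wpM2r ?exprn_ge0 ?(ltW Q0) //.
    by rewrite -mulr_natl /Q ler_pdivrMr // mul1r ler_nat.
  by rewrite exprVn ler_pdivrMr ?exprn_gt0 // -natrX -natrM ler_nat.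
have cX : cone X.
  split=> [|a v].
    have [w wX] : exists w, w \in X0.
      apply/card_gt0P; rewrite lt0n; apply: contraTneq bigX0 => ->.
      by rewrite mul0n -ltnNge.
    rewrite inE; apply/exists_inP; exists w => //.
    by apply/existsP; exists 0; rewrite scale0r.
  rewrite !inE => /exists_inP[w wX /existsP[b /eqP ->]].
  apply/exists_inP; exists w => //; apply/existsP.
  by exists (a * b); rewrite scalerA.
have bigX : (#|{: 'rV[F]_n}| <= #|X| * q ^ s.+1)%N.
  by apply: leq_trans bigX0 _; rewrite leq_mul2r subset_leq_card ?orbT.
have [||v|W [W0 Wa bigW PW]] := exists_subspace_in_sumset
    (P := fun a v => prank_le D' a (Tv v)) (r := R0) cX bigX.
- move=> a b u v hu hv; apply: prank_ext (prank_add hu hv) => x.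
  by rewrite /Tv (mlin_updD _ _ _ hT iD).
- by move=> a b v ab; apply: prank_mono.
- rewrite inE => /exists_inP[w]; rewrite inE => wX /existsP[a /eqP ->].
  apply: prank_ext (prank_scale a (HR0 _ _ _ _ _ cD' (hTv w) hchi nchi wX)) => x.
  by rewrite /Tv (mlin_updZ _ _ _ hT iD).
have [m' [pr [l [e [mm [prL prW lL vE]]]]]] := exists_projector W0 Wa bigW.
(* [T - T'] splits along the [m'] coordinates of a complement of the subspace, with one product for
   each. *)
pose T' x := T (upd x i (pr (x i))).
have hT' : mlin D T'.
  split=> [x y xy|j jD x a u v].
    by apply: hT.1 => j jD; rewrite !updE (xy i iD); case: eqP => // _; apply: xy.
  rewrite /T'; have [->|ji] := eqVneq j i.
    by rewrite !upd_upd !updE eqxx prL hT.2.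
  rewrite !updE [i == j]eq_sym (negPf ji).
  by rewrite ![upd (upd x j _) i _]updC // hT.2.
have [c [[s0 cs0] cN cI]] := HN F D' i0 i0D' cD'.
have nT' : prank_le D #|{ffun I -> {perm 'I_N}}| T'.
  apply: (rank_le_of_identity i0D hT' (c := fun s => c (upd s i 1%g))).
  - exists s0; suff -> : upd s0 i 1%g = s0 by [].
    apply/ffunP => k; rewrite updE; case: eqP => [->|//].
    by rewrite (cN _ cs0).2 // !inE eqxx.
  - move=> t /cN[t0 tD]; split.
      move: t0; rewrite updE; case: eqP => // e0.
      by move: i0D'; rewrite e0 !inE eqxx.
    move=> k kD; have := tD k; rewrite updE !inE (negPf kD) andbF.
    by case: eqP => [ki|_ -> //]; rewrite ki iD in kD.
  apply: (identity_polarize hT' iD cN) => v; apply: cI.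
  apply: prank_ext (PW (pr v) (prW v)) => x.
  by rewrite /T' /Tv upd_upd updE eqxx.
have hrest : prank_le D s.+1 (fun x => \sum_k l k (x i) * T (upd x i (e k))).
  apply: prank_mono mm _; rewrite -{1}(card_ord m').
  apply: (prank_sum (F := fun k x => l k (x i) * T (upd x i (e k)))) => k _.
  apply: (@prank_mul _ _ _ _ [set i]).
  - by apply/set0Pn; exists i; rewrite inE.
  - rewrite properEcard sub1set iD cards1 cD; by [].
  - split=> [x y xy|j]; first by rewrite xy // inE.
    by rewrite inE => /eqP -> x a u v; rewrite !updE eqxx lL.
  exact: mlin_upd.
apply: prank_ext (prank_add nT' hrest) => x.
have -> : T x = T (upd x i (pr (x i) + \sum_k l k (x i) *: e k)) by rewrite -vE upd_id.
rewrite (mlin_updD _ _ _ hT iD); congr (_ + _); rewrite (mlin_upd_sum _ _ _ _ hT iD); apply: eq_bigr => k _.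
by rewrite (mlin_updZ _ _ _ hT iD).
Qed.

(** * Weyl differencing *)

Section Differencing.
Variables (A : finComNzRingType) (n : nat).
Local Notation V := 'rV[A]_n.
Implicit Types (g f : V -> A) (u v h x : V).

Definition dif h g : V -> A := fun x => g (x + h) - g x.

Definition difs (J : finType) (h : {ffun J -> V}) (g : V -> A) (s : seq J) : V -> A :=
  foldl (fun f j => dif (h j) f) g s.

Lemma dif_ext h g f : g =1 f -> dif h g =1 dif h f.
Proof. by move=> e x; rewrite /dif !e. Qed.

Lemma difs_ext (J : finType) (h : {ffun J -> V}) g f s :
  g =1 f -> difs h g s =1 difs h f s.
Proof. by elim: s g f => [|j s IH] g f e //=; apply: IH; apply: dif_ext. Qed.

Lemma difs_dif (J : finType) (h : {ffun J -> V}) g s u :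
  difs h (dif u g) s =1 dif u (difs h g s).
Proof.
elim: s g => [|j s IH] g //= x; rewrite -[RHS]IH; apply: difs_ext => y.
by rewrite /dif [y + u + h j]addrAC; ring.
Qed.

Lemma difs_upd (J : finType) (h : {ffun J -> V}) g s j u :
  j \notin s -> difs (upd h j u) g s = difs h g s.
Proof.
elim: s g => [|k s IH] g //=; rewrite inE negb_or => /andP[jk js].
by rewrite IH // updE eq_sym (negPf jk).
Qed.

(** Degree is attached to functions, with variables taken out one at a time, so that differencing is
    handled by induction. *)
Fixpoint deg_le (m : nat) (g : V -> A) : Prop :=
  match m with
  | 0 => exists c, forall x, g x = c
  | m'.+1 => exists c (G : 'I_n -> V -> A), (forall i, deg_le m' (G i)) /\
      forall x, g x = c + \sum_i x 0 i * G i x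
  end.

Lemma deg_le_ext m g f : g =1 f -> deg_le m g -> deg_le m f.
Proof.
case: m => [|m] e /= [c h]; first by exists c => x; rewrite -e.
by case: h => G [hG eG]; exists c, G; split=> // x; rewrite -e.
Qed.

Lemma deg_le_const m c : deg_le m (fun=> c).
Proof.
elim: m c => [|m IH] c /=; first by exists c.
by exists c, (fun _ _ => 0); split=> // x; rewrite big1 ?addr0 // => i _; rewrite mulr0.
Qed.

Lemma deg_le_add m g f : deg_le m g -> deg_le m f -> deg_le m (fun x => g x + f x).
Proof.
elim: m g f => [|m IH] g f /= [c hg] [c' hf].
  by exists (c + c') => x; rewrite hg hf.
case: hg hf => G [dG eG] [G' [dG' eG']].
exists (c + c'), (fun i x => G i x + G' i x); split=> [i|x]; first exact: IH.
rewrite eG eG' addrACA -big_split /=; congr (_ + _).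
by apply: eq_bigr => i _; rewrite mulrDr.
Qed.

Lemma deg_le_sum m (K : Type) (s : seq K) (G : K -> V -> A) :
  (forall k, deg_le m (G k)) -> deg_le m (fun x => \sum_(k <- s) G k x).
Proof.
move=> hG; elim: s => [|k s IH].
  by apply: deg_le_ext (deg_le_const m 0) => x; rewrite big_nil.
by apply: deg_le_ext (deg_le_add (hG k) IH) => x; rewrite big_cons.
Qed.

Lemma deg_le_S m g : deg_le m g -> deg_le m.+1 g.
Proof.
elim: m g => [|m IH] g [c hg].
  by apply: deg_le_ext (deg_le_const 1 c) => x; rewrite hg.
by case: hg => G [dG eG]; exists c, G; split=> [i|//]; apply: IH; apply: dG.
Qed.

Lemma deg_le_mono m m' g : (m <= m')%N -> deg_le m g -> deg_le m' g.
Proof.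
move=> /subnKC <-; elim: (m' - m)%N => [|k IH]; first by rewrite addn0.
by move=> hg; rewrite addnS; apply/deg_le_S/IH.
Qed.

Lemma deg_le_coord m i g : deg_le m g -> deg_le m.+1 (fun x => x 0 i * g x).
Proof.
move=> hg; exists 0, (fun k => if k == i then g else fun=> 0); split=> [k|x].
  by case: ifP => // _; apply: deg_le_const.
rewrite add0r (bigD1 i) //= eqxx big1 ?addr0 // => k /negPf ->.
by rewrite mulr0.
Qed.

Lemma deg_le_scale m c g : deg_le m g -> deg_le m (fun x => c * g x).
Proof.
elim: m g => [|m IH] g /= [c' hg]; first by exists (c * c') => x; rewrite hg.
case: hg => G [dG eG]; exists (c * c'), (fun i x => c * G i x); split=> [i|x].
  exact: IH.
by rewrite eG mulrDr mulr_sumr; congr (_ + _); apply: eq_bigr => i _; rewrite mulrCA.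
Qed.

Lemma deg_le_mul m m' g f : deg_le m g -> deg_le m' f -> deg_le (m + m') (fun x => g x * f x).
Proof.
elim: m g => [|m IH] g [c hg] hf.
  by apply: deg_le_ext (deg_le_scale c hf) => x; rewrite hg.
case: hg => G [dG eG]; rewrite addSn.
apply: (@deg_le_ext _ (fun x => c * f x + \sum_(i <- enum 'I_n) x 0 i * (G i x * f x))).
  move=> x; rewrite eG mulrDl mulr_suml big_enum /=; congr (_ + _).
  by apply: eq_bigr => i _; rewrite mulrA.
apply: deg_le_add; first by apply: deg_le_mono (deg_le_scale c hf); rewrite -addSn leq_addl.
apply: (@deg_le_sum _ _ _ (fun i x => x 0 i * (G i x * f x))) => i.
by apply: (@deg_le_coord _ i (fun x => G i x * f x)); apply: IH (dG i) hf.
Qed.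

(** Product rule: the difference of [x_i G] is [x_i] times that of [G], plus [h_i G], plus [h_i]
    times the difference of [G]. *)
Lemma deg_le_dif m h g : deg_le m.+1 g -> deg_le m (dif h g).
Proof.
elim: m g => [|m IH] g [c [G [dG eG]]].
  exists (\sum_i h 0 i * G i 0) => x; rewrite /dif !eG opprD addrACA subrr add0r.
  rewrite -sumrB; apply: eq_bigr => i _; case: (dG i) => a Ga.
  by rewrite !Ga mxE; ring.
apply: (@deg_le_ext _ (fun x => \sum_(i <- enum 'I_n)
    (x 0 i * dif h (G i) x + (h 0 i * G i x + h 0 i * dif h (G i) x)))).
  move=> x; rewrite /dif !eG opprD addrACA subrr add0r big_enum -sumrB /=.
  by apply: eq_bigr => i _; rewrite mxE; ring.
apply: (@deg_le_sum _ _ _ (fun i x => x 0 i * dif h (G i) x +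
  (h 0 i * G i x + h 0 i * dif h (G i) x))) => i.
apply: deg_le_add; first by apply: (@deg_le_coord _ i (dif h (G i))); apply: IH (dG i).
by apply: deg_le_add; apply: deg_le_scale; [exact: dG|apply/deg_le_S/IH/dG].
Qed.

Lemma deg_le_difs (J : finType) (h : {ffun J -> V}) m g s :
  deg_le (m + size s) g -> deg_le m (difs h g s).
Proof.
elim: s g => [|j s IH] g /=; first by rewrite addn0.
by rewrite addnS => hg; apply/IH/deg_le_dif.
Qed.

Definition eval (P : {mpoly A[n]}) : V -> A := fun x => P.@[fun i => x 0 i].

Lemma deg_le_eval m P : (msize P <= m.+1)%N -> deg_le m (eval P).
Proof.
move=> hP; apply: (@deg_le_ext _ (fun x =>
    \sum_(k <- msupp P) (if (mdeg k <= m)%N then P@_k else 0) * \prod_i x 0 i ^+ k i)).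
  move=> x; rewrite /eval mevalE big_seq [RHS]big_seq; apply: eq_bigr => k kP.
  by rewrite -ltnS (leq_trans (msize_mdeg_lt kP) hP).
apply: deg_le_sum => k; case: leqP => [km|_]; last first.
  by apply: deg_le_ext (deg_le_const m 0) => x; rewrite mul0r.
apply: deg_le_scale; apply: deg_le_mono km _; rewrite mdegE.
have hX i e : deg_le e (fun x => x 0 i ^+ e).
  elim: e => [|e IH]; first by exists 1 => x; rewrite expr0.
  by apply: deg_le_ext (deg_le_coord i IH) => x; rewrite exprS.
elim: (index_enum _) => [|i s IH].
  by apply: deg_le_ext (deg_le_const _ 1) => x; rewrite big_nil.
rewrite big_cons; apply: deg_le_ext (deg_le_mul (hX i (k i)) IH) => x.
by rewrite big_cons.
Qed.

(* The top difference of a function of degree [d] is constant; any of the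
   differences can be taken last, hence it is linear in each of them. *)
Lemma mlin_difs (d : nat) (g : V -> A) : deg_le d g ->
  mlin [set: 'I_d] (fun h : {ffun 'I_d -> V} => difs h g (enum 'I_d) 0).
Proof.
move=> hg; split=> [x y xy|j _ h a u v].
  by have -> : x = y by apply/ffunP => j; apply: xy; rewrite inE.
have je : j \in enum 'I_d by rewrite mem_enum.
have us := enum_uniq 'I_d; have sz := size_enum_ord d.
case/splitPr: je us sz => s1 s2 us sz.
have jn : j \notin s1 ++ s2.
  by move: us; rewrite -cat1s uniq_catCA /= => /andP[].
have E w : difs (upd h j w) g (s1 ++ j :: s2) 0 = dif w (difs h g (s1 ++ s2)) 0.
  rewrite -(difs_upd h g w jn) /difs !foldl_cat /= -!/(difs _ _ _).
  by rewrite updE eqxx difs_dif.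
have : deg_le 1 (difs h g (s1 ++ s2)).
  apply: deg_le_difs; suff -> : (1 + size (s1 ++ s2))%N = size (s1 ++ j :: s2).
    by rewrite sz.
  by rewrite !size_cat /= addnS add1n.
case=> c [G [dG eG]].
have L w : dif w (difs h g (s1 ++ s2)) 0 = \sum_i w 0 i * G i 0.
  rewrite /dif !eG opprD addrACA subrr add0r -sumrB; apply: eq_bigr => i _.
  by case: (dG i) => b Gb; rewrite !Gb !mxE; ring.
rewrite !E !L mulr_sumr -big_split /=; apply: eq_bigr => i _.
by rewrite !mxE; ring.
Qed.

Section Weyl.
Variable chi : A -> algC.
Hypothesis chiP : add_char chi.

Lemma avg_exp2_le (T : finType) (t0 : T) (f : T -> algC) (k : nat) :
  (forall t, 0 <= f t) -> avg f ^+ (2 ^ k)%N <= avg (fun t => f t ^+ (2 ^ k)%N).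
Proof.
elim: k f => [|k IH] f f0; first by rewrite expr1.
rewrite expnS exprM; apply: (@le_trans _ _ (avg (fun t => f t ^+ 2) ^+ (2 ^ k)%N)).
  apply: lerXn2r; rewrite ?nnegrE ?exprn_ge0 ?avg_ge0 //.
    by move=> t; apply: exprn_ge0.
  exact: avg_sqr_le.
apply: le_trans (IH _ _) _ => [t|]; first exact: exprn_ge0.
by apply: avg_le => t; rewrite exprM.
Qed.

Lemma norm_avg_sqr g :
  `|avg (fun x => chi (g x))| ^+ 2 = avg (fun h => avg (fun x => chi (dif h g x))).
Proof.
rewrite normCK avg_conj -avgZ avg_exchange; apply: eq_avg => x.
rewrite -avgZr -(avg_addl x); apply: eq_avg => h.
by rewrite -add_charN // -add_charD.
Qed.

(** Each squaring adds one difference; [avg_exp2_le] moves the remaining powers of two inside the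
    average over [h]. *)
Lemma norm_avg_weyl (J : finType) j (s : seq J) g : uniq (j :: s) ->
  `|avg (fun x => chi (g x))| ^+ (2 ^ (size s).+1) <=
  avg (fun h : {ffun J -> V} => avg (fun x => chi (difs h g (j :: s) x))).
Proof.
elim: s j g => [|k s IH] j g /=; [move=> _|move=> /andP[jk us]].
  rewrite norm_avg_sqr (avg_upd j) /=.
  rewrite [leRHS](eq_avg (g := fun u => avg (fun x => chi (dif u g x)))) // => u.
  rewrite (eq_avg (g := fun=> avg (fun x => chi (dif u g x)))) ?(avg_const (0 : {ffun J -> V})) //.
  by move=> h; rewrite updE eqxx.
rewrite expnS exprM norm_avg_sqr.
apply: (@le_trans _ _ (avg (fun h => `|avg (fun x => chi (dif h g x))|) ^+ (2 ^ (size s).+1))).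
  have r0 : 0 <= avg (fun h => avg (fun x => chi (dif h g x))).
    by rewrite -norm_avg_sqr exprn_ge0.
  apply: lerXn2r; rewrite ?nnegrE //.
    by apply: avg_ge0.
  exact: le_trans (real_ler_norm (ger0_real r0)) (norm_avg _).
apply: le_trans (avg_exp2_le 0 _ _) _ => //.
rewrite (avg_upd j); apply: avg_le => u; apply: le_trans (IH k (dif u g) us) _.
rewrite le_eqVlt; apply/orP; left; apply/eqP; apply: eq_avg => h; apply: eq_avg => x.
by rewrite -(difs_upd h (dif u g) u jk) /= [upd h j u j]updE eqxx.
Qed.

End Weyl.

(** After as many differences as the degree, the function is constant in [x] and the inner average
    of [norm_avg_weyl] drops out. *)
Lemma bias_weyl (chi : A -> algC) (d : nat) (P : {mpoly A[n]}) : add_char chi ->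
  msize P = d.+2 ->
  `|avg (fun x => chi (eval P x))| ^+ (2 ^ d.+1) <=
  bias chi (fun h : {ffun 'I_d.+1 -> V} => difs h (eval P) (enum 'I_d.+1) 0).
Proof.
move=> hchi sP; have := enum_uniq 'I_d.+1; have := size_enum_ord d.+1.
have cst (h : {ffun 'I_d.+1 -> V}) x :
    difs h (eval P) (enum 'I_d.+1) x = difs h (eval P) (enum 'I_d.+1) 0.
  have [|c hc] := @deg_le_difs _ h 0 (eval P) (enum 'I_d.+1); last by rewrite !hc.
  by rewrite size_enum_ord; apply: deg_le_eval; rewrite sP.
have E : bias chi (fun h : {ffun 'I_d.+1 -> V} => difs h (eval P) (enum 'I_d.+1) 0) =
    avg (fun h : {ffun 'I_d.+1 -> V} => avg (fun x => chi (difs h (eval P) (enum 'I_d.+1) x))).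
  apply: eq_avg => h; rewrite [RHS](eq_avg (g := fun=> chi (difs h (eval P) (enum 'I_d.+1) 0))).
    by rewrite (avg_const (0 : V)).
  by move=> x; rewrite cst.
rewrite E; case: (enum _) => // j s sz us.
have := norm_avg_weyl hchi (eval P) us.
by rewrite (_ : (size s).+1 = d.+1).
Qed.

Lemma PtildeE (d : nat) (P : {mpoly A[n]}) (h : {ffun 'I_d -> V})
    (hs : 'I_d -> 'I_n -> A) : (forall j i, hs j i = h j 0 i) ->
  Ptilde P hs = difs h (eval P) (enum 'I_d) 0.
Proof.
move=> hsE; rewrite /Ptilde /difs.
suff H (s : seq 'I_d) (f : ('I_n -> A) -> A) g :
    (forall (v : 'I_n -> A) x, (forall i, v i = x 0 i) -> f v = g x) ->
    forall (v : 'I_n -> A) x, (forall i, v i = x 0 i) ->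
    foldl (fun (F : ('I_n -> A) -> A) j => diffop (hs j) F) f s v = foldl (fun f j => dif (h j) f) g s x.
  apply: H => [v x vx|i]; last by rewrite mxE.
  by apply: meval_eq.
elim: s f g => [|j s IH] f g fg //=.
apply: IH => v x vx; rewrite /diffop /dif; congr (_ - _); apply: fg => i.
  by rewrite mxE vx hsE.
exact: vx.
Qed.

End Differencing.

(** * From partition rank to Schmidt rank *)

Definition basis_at (I : finType) (R : finComNzRingType) (n : nat) (t : {ffun I -> 'I_n}) :
  {ffun I -> 'rV[R]_n} := [ffun j => delta_mx 0 (t j)].

Section Expansion.
Variables (I : finType) (R : finComNzRingType) (n : nat).
Implicit Types (T : {ffun I -> 'rV[R]_n} -> R).

Lemma mlin_eq0 T : mlin [set: I] T -> (forall t, T (basis_at R t) = 0) -> forall x, T x = 0.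
Proof.
move=> hT T0 x.
(* Induction on the number of directions in which [y] is not a standard basis vector. *)
suff main m (y : {ffun I -> 'rV[R]_n}) :
    (#|[set j | ~~ [exists k, y j == (delta_mx 0 k)%R]]| <= m)%N -> T y = 0 by exact: main (leqnn _).
elim: m y => [|m IH] y; set E := [set j | _] => cE; have [E0|[j jE]] := set_0Vmem E.
- have h j : exists k, y j = delta_mx 0 k.
    have : j \notin E by rewrite E0 inE.
    by rewrite inE negbK => /existsP[k /eqP]; exists k.
  have [t ht] := fin_all_exists h.
  rewrite (_ : y = basis_at R [ffun j => t j]) ?T0 //.
  by apply/ffunP => j; rewrite !ffunE ht.
- by move: cE; rewrite (cardsD1 j) jE.
- by apply: IH; rewrite -/E E0 cards0.
rewrite -(upd_id y j) (row_sum_delta (y j)) (mlin_upd_sum _ _ _ _ hT) ?inE // big1 // => k _.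
rewrite (mlin_updZ _ _ _ hT) ?inE // IH ?mulr0 //.
have : (#|E :\ j| <= m)%N by move: cE; rewrite (cardsD1 j) jE.
apply: leq_trans; apply: subset_leq_card; apply/subsetP => i; rewrite !inE updE.
case: eqP => // _; apply: contraR => _; apply/existsP; by exists k.
Qed.

Lemma mlin_sum (D : {set I}) (K : Type) (s : seq K) (G : K -> {ffun I -> 'rV[R]_n} -> R) :
  (forall k, mlin D (G k)) -> mlin D (fun x => \sum_(k <- s) G k x).
Proof.
move=> hG; elim: s => [|k s IH].
  by apply: mlin_ext (mlin0 R n D) => x; rewrite big_nil.
by apply: mlin_ext (mlin_add (hG k) IH) => x; rewrite big_cons.
Qed.

Lemma mlin_monomial (t : {ffun I -> 'I_n}) :
  mlin [set: I] (fun x : {ffun I -> 'rV[R]_n} => \prod_j x j 0 (t j)).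
Proof.
split=> [x y xy|i _ x a u v]; first by apply: eq_bigr => j _; rewrite xy ?inE.
rewrite !(bigD1 i (P := xpredT)) //= !updE eqxx !mxE.
have e w : \prod_(j | j != i) (upd x i w) j 0 (t j) = \prod_(j | j != i) x j 0 (t j).
  by apply: eq_bigr => j /negPf ji; rewrite updE ji.
by rewrite !e; ring.
Qed.

Lemma mlin_form (c : {ffun I -> 'I_n} -> R) :
  mlin [set: I] (fun x : {ffun I -> 'rV[R]_n} => \sum_t c t * \prod_j x j 0 (t j)).
Proof.
have := mlin_sum (enum {ffun I -> 'I_n}) (fun t => mlin_scale (c t) (mlin_monomial t)).
by apply: mlin_ext => x; rewrite big_enum.
Qed.

Lemma form_basis (c : {ffun I -> 'I_n} -> R) (u : {ffun I -> 'I_n}) :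
  \sum_t c t * \prod_j (basis_at R u) j 0 (t j) = c u.
Proof.
rewrite (bigD1 u) //= [X in _ + X]big1 ?addr0 => [|t tu].
  by rewrite big1 ?mulr1 // => j _; rewrite ffunE mxE !eqxx.
have [j jn] : exists j, t j != u j.
  apply/existsP; apply: contraR tu => /existsPn h; apply/eqP/ffunP => j.
  by apply/eqP; move: (h j); rewrite negbK.
by rewrite (bigD1 j) //= ffunE mxE eqxx (negPf jn) mul0r mulr0.
Qed.

Lemma mlin_expand T : mlin [set: I] T ->
  forall x, T x = \sum_t T (basis_at R t) * \prod_j x j 0 (t j).
Proof.
move=> hT x; apply/eqP; rewrite -subr_eq0; apply/eqP.
have hS := mlin_form (fun t => T (basis_at R t)).
apply: (mlin_eq0 (mlin_add hT (mlin_opp hS))) => t.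
by rewrite form_basis subrr.
Qed.

End Expansion.

Section Schmidt.
Variables (F : finFieldType) (d n : nat).
Local Notation X := {ffun 'I_d -> 'rV[F]_n}.
Local Notation Tm := {ffun 'I_d -> 'I_n}.

Definition form_mpoly (T : X -> F) : {mpoly F[d * n]} :=
  \sum_(t : Tm) T (basis_at F t) *: \prod_(j < d) 'X_(mxvec_index j (t j)).

(** Setting [t] to the placeholder [k0] outside [J] counts every map from [J] to ['I_n] exactly
    once. *)
Definition part_mpoly (k0 : 'I_n) (J : {set 'I_d}) (Q : X -> F) : {mpoly F[d * n]} :=
  \sum_(t : Tm | t \in pffun_on k0 (mem J) predT)
    Q (basis_at F t) *: \prod_(j in J) 'X_(mxvec_index j (t j)).

Lemma msize_part_mpoly k0 (J : {set 'I_d}) Q : (msize (part_mpoly k0 J Q) <= #|J|.+1)%N.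
Proof.
rewrite /part_mpoly; elim/big_ind: _ => [|p q hp hq|t _]; first by rewrite msize0.
  by apply: leq_trans (msizeD_le _ _) _; rewrite geq_max hp.
apply: leq_trans (msizeZ_le _ _) _.
have -> : \prod_(j in J) 'X_(mxvec_index j (t j)) =
    'X_[\sum_(j in J) U_(mxvec_index j (t j))] :> {mpoly F[d * n]}.
  by rewrite (big_morph _ (@mpolyXD _ F) (mpolyX0 _ F)).
rewrite msizeX mdeg_sum ltnS -sum1_card; apply: leq_sum => j _.
by rewrite mdeg1.
Qed.

Lemma form_mpoly_mul (k0 : 'I_n) (J : {set 'I_d}) (Q G : X -> F) :
  mlin J Q -> mlin (~: J) G ->
  form_mpoly (fun x => Q x * G x) = part_mpoly k0 J Q * part_mpoly k0 (~: J) G.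
Proof.
move=> mQ mG; rewrite /part_mpoly big_distrlr /= pair_big /=.
pose res (E : {set 'I_d}) (t : Tm) : Tm := [ffun j => if j \in E then t j else k0].
pose glue (p : Tm * Tm) : Tm := [ffun j => if j \in J then p.1 j else p.2 j].
have resP E t : res E t \in pffun_on k0 (mem E) predT.
  apply/pffun_onP; split=> //; apply/subsetP => j; rewrite !inE ffunE.
  by case: ifP => //; rewrite eqxx.
rewrite (reindex_onto (fun t => (res J t, res (~: J) t)) glue) /=; last first.
  case=> t1 t2 /= /andP[/pffun_onP[/subsetP h1 _] /pffun_onP[/subsetP h2 _]].
  congr pair; apply/ffunP => j; rewrite !ffunE ?inE.
    have [//|jJ] := boolP (j \in J).
    by apply/esym/eqP; apply: contraR jJ => /h1.
  have [jJ|//] := boolP (j \in J).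
  by apply/esym/eqP; move: jJ; apply: contraLR => /h2; rewrite inE.
apply: eq_big => [t|t _].
  rewrite !resP /=; apply/esym/eqP/ffunP => j; rewrite !ffunE inE.
  by case: (j \in J).
rewrite -scalerAl -scalerAr scalerA; congr (_ * _ *: _).
- by apply: mQ.1 => j jJ; rewrite !ffunE jJ.
- by apply: mG.1 => j jJ; rewrite !ffunE jJ.
rewrite (bigID (mem J)) /=; congr (_ * _); first by apply: eq_bigr => j jJ; rewrite ffunE jJ.
by apply: eq_big => [j|j jJ]; rewrite ?inE // ffunE inE jJ.
Qed.

Lemma schmidt_of_prank (r : nat) (T : X -> F) : (0 < d)%N -> prank_le [set: 'I_d] r T ->
  exists2 r', (r' <= r)%N & schmidt_decomp (form_mpoly T) d r'.
Proof.
move=> d0; elim=> {r T} [r T T0|r J Q G T T' J0 JD mQ mG _ [r' r'r [Qs [Rs [sz eT']]]] eT].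
  exists 0%N => //; exists (fun _ => 0), (fun _ => 0); split; first by case.
  by rewrite big_ord0 /form_mpoly big1 // => t _; rewrite T0 scale0r.
have eF : form_mpoly T = form_mpoly (fun x => Q x * G x) + form_mpoly T'.
  by rewrite /form_mpoly -big_split /=; apply: eq_bigr => t _; rewrite eT scalerDl.
(* For [n = 0] no placeholder [k0] exists, but the polynomial is then an empty sum. *)
have [|n0] := posnP n.
  move=> n0; exists 0%N => //; exists (fun _ => 0), (fun _ => 0); split; first by case.
  rewrite big_ord0 /form_mpoly big1 // => t _.
  by have := ltn_ord (t (Ordinal d0)); rewrite [X in (_ < X)%N]n0.
pose k0 := Ordinal n0; rewrite setTD in mG.
exists r'.+1; first by rewrite ltnS.
exists (fun i => oapp Qs (part_mpoly k0 J Q) (unlift ord0 i)),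
       (fun i => oapp Rs (part_mpoly k0 (~: J) G) (unlift ord0 i)).
split=> [i|]; last first.
  rewrite eF (form_mpoly_mul k0 mQ mG) eT' big_ord_recl unlift_none /=; congr (_ + _).
  by apply: eq_bigr => i _; rewrite liftK.
case: unliftP => [j _|_] /=; first exact: sz.
(* Both factors have degree below [d] because [J] is neither empty nor everything. *)
split; apply: leq_trans (msize_part_mpoly _ _ _) _.
  by have := proper_card JD; rewrite cardsT card_ord.
have J1 : (0 < #|J|)%N by rewrite card_gt0.
by have := cardsC J; rewrite card_ord; lia.
Qed.

End Schmidt.

(** * The rings [A_l] *)

Section Quotient.
Variables (O : idomainType) (pi : O) (F : finFieldType) (l : nat) (A : finComNzRingType).
Variables (phi : {rmorphism O -> A}) (psi : {rmorphism A -> F}).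
Hypotheses (pi0 : pi != 0) (psi_surj : forall y : F, exists x : O, psi (phi x) = y).
Hypothesis psi_ker : forall x : O, psi (phi x) = 0 <-> rdvd pi x.
Hypothesis phi_surj : forall y : A, exists x : O, phi x = y.
Hypothesis phi_ker : forall x : O, phi x = 0 <-> rdvd (pi ^+ l) x.
Let w := phi pi.

Lemma unif_exp_l : w ^+ l = 0.
Proof. by rewrite -rmorphXn; apply/phi_ker; exists 1; rewrite mulr1. Qed.

Lemma residue_eq0 a : psi a = 0 <-> exists c, a = w * c.
Proof.
split=> [|[c ->]].
  have [x <-] := phi_surj a; case/psi_ker=> c ->.
  by exists (phi c); rewrite rmorphM.
by have [x <-] := phi_surj c; rewrite -rmorphM; apply/psi_ker; exists x.
Qed.

Lemma residue_eq a b : psi a = psi b -> exists c, a = b + w * c.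
Proof.
move=> e; have [|c ec] := (residue_eq0 (a - b)).1; first by rewrite rmorphB e subrr.
by exists c; rewrite -ec addrC subrK.
Qed.

(** Lift to the domain [O], where [pi ^+ m] cancels. *)
Lemma annihilator_exp m a : (m <= l)%N -> w ^+ m * a = 0 -> exists b, a = w ^+ (l - m) * b.
Proof.
move=> ml; have [x <-] := phi_surj a; rewrite -rmorphXn -rmorphM.
move/phi_ker=> [c]; rewrite -{1}(subnKC ml) exprD -mulrA.
move/(mulfI (expf_neq0 m pi0)) ->.
by exists (phi c); rewrite rmorphM rmorphXn.
Qed.

(** Each layer contributes a factor [#|F|]: an element of [w^m A] is uniquely [w^m] times a chosen
    residue representative plus an element of [w^(m+1) A]. *)
Lemma card_ideal_exp t : (t <= l)%N ->
  #|[set w ^+ (l - t) * a | a : A]| = (#|F| ^ t)%N.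
Proof.
elim: t => [_|t IH tl].
  rewrite subn0 unif_exp_l expn0 -(cards1 (0 : A)); congr #|pred_of_set _|; apply/setP => z.
  rewrite inE; apply/imsetP/eqP => [[a _ ->]|->]; first by rewrite mul0r.
  by exists 0; rewrite ?mulr0.
set m := (l - t.+1)%N; have em : (l - t = m.+1)%N by rewrite subnSK.
have lift (y : F) : exists a : A, psi a = y.
  by have [x <-] := psi_surj y; exists (phi x).
have [lf lfE] := fin_all_exists lift.
pose S := [set w ^+ m.+1 * a | a : A].
pose f (yz : F * A) := w ^+ m * lf yz.1 + yz.2.
rewrite expnS -IH ?(ltnW tl) // em -/S -[#|F|]cardsT -cardsX.
have fi : {in setX setT S &, injective f}.
  move=> [y z] [y' z'] /setXP[_ /imsetP[a _ ->]] /setXP[_ /imsetP[a' _ ->]].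
  rewrite /f /= => e; have ml : (m <= l)%N by apply: leq_subr.
  suff yy : y = y' by move: e; rewrite yy => /addrI ->.
  have [|b hb] := @annihilator_exp m (lf y - lf y' + w * (a - a')) ml.
    apply/eqP; rewrite mulrDr mulrA -exprSr !mulrBr addrACA -opprD subr_eq0.
    exact/eqP.
  rewrite -(lfE y) -(lfE y'); apply/eqP; rewrite -subr_eq0 -rmorphB; apply/eqP.
  apply/residue_eq0; exists (w ^+ t * b - (a - a')).
  rewrite mulrBr mulrA -exprS; apply/eqP; rewrite eq_sym subr_eq; apply/eqP.
  by rewrite hb /m subKn.
rewrite -(card_in_imset fi); congr #|pred_of_set _|; apply/setP => v.
apply/imsetP/imsetP => [[a _ ->]|[[y _] /setXP[_ /imsetP[a _ ->]] ->]]; last first.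
  by exists (lf y + w * a); rewrite // /f mulrDr mulrA -exprSr.
have [c ec] := residue_eq (esym (lfE (psi a))).
exists (psi a, w ^+ m.+1 * c); first by apply/setXP; split=> //; apply: imset_f.
by rewrite /f /= exprSr -mulrA -mulrDr -ec.
Qed.

Lemma card_quotient_ring : #|A| = (#|F| ^ l)%N.
Proof.
rewrite -card_ideal_exp // subnn -cardsT; congr #|pred_of_set _|.
by apply/setP => a; rewrite inE; apply/esym/imsetP; exists a; rewrite // mul1r.
Qed.

Variable chi : A -> algC.
Hypotheses (chiP : add_char chi) (chi_nontriv : exists x, chi x != 1).
Let k := dchi chi w.

(** The search in [dchi] succeeds because [l] is in its range, [#|A|] being [#|F| ^ l]; minimality
    gives the last clause. *)
Lemma dchiP : [/\ (0 < k)%N, forall a, chi (w ^+ k * a) = 1 &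
  exists a, chi (w ^+ k.-1 * a) != 1].
Proof.
have lA : (l < #|A|.+1)%N.
  by rewrite ltnS card_quotient_ring ltnW // ltn_expl // finNzRing_gt1.
have h : has (trivial_on chi w) (iota 0 #|A|.+1).
  apply/hasP; exists l; first by rewrite mem_iota.
  by apply/forallP => a; rewrite unif_exp_l mul0r add_char0.
have kA : (k < #|A|.+1)%N by move: h; rewrite has_find size_iota.
have kt : trivial_on chi w k by have := nth_find 0%N h; rewrite nth_iota.
have k0 : (0 < k)%N.
  rewrite lt0n; apply/eqP => k0; case: chi_nontriv => x /negP; apply.
  by move/forallP: kt => /(_ x); rewrite k0 expr0 mul1r.
split=> // [a|]; first by apply/eqP; move/forallP: kt; apply.
have kk : (k.-1 < k)%N by rewrite prednK.
have := before_find 0%N kk; rewrite nth_iota ?add0n; last exact: ltn_trans kk kA.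
move/negbT; rewrite negb_forall => /existsP[a ha]; by exists a.
Qed.

(* Well defined because [chi] is trivial on [w^k A]. *)
Definition residue_char (y : F) : algC :=
  chi (w ^+ k.-1 * odflt 0 [pick a | psi a == y]).

Lemma residue_charE a : residue_char (psi a) = chi (w ^+ k.-1 * a).
Proof.
rewrite /residue_char; case: pickP => [b /eqP /= e|/(_ a)]; last by rewrite eqxx.
have [k0 kt _] := dchiP; have [c ->] := residue_eq e.
by rewrite mulrDr mulrA -exprSr prednK // add_charD // kt mulr1.
Qed.

Lemma residue_surj (y : F) : exists a : A, psi a = y.
Proof. by have [x <-] := psi_surj y; exists (phi x). Qed.

Lemma residue_char_add : add_char residue_char.
Proof.
split=> [x y|x].
  have [a <-] := residue_surj x; have [b <-] := residue_surj y.
  by rewrite -rmorphD !residue_charE mulrDr add_charD.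
by have [a <-] := residue_surj x; rewrite residue_charE; apply: chiP.2.
Qed.

Lemma residue_char_nontriv : exists y, residue_char y != 1.
Proof. by have [_ _ [a ha]] := dchiP; exists (psi a); rewrite residue_charE. Qed.

(** At level 1 the character sees only residues, and reduction is a surjective homomorphism of
    finite groups, so both averages agree. *)
Lemma bias_residue (I : finType) (n : nat) (T : {ffun I -> 'rV[A]_n} -> A) :
  mlin [set: I] T ->
  bias (fun a => chi (w ^+ k.-1 * a)) T =
  bias residue_char (fun x : {ffun I -> 'rV[F]_n} =>
    \sum_t psi (T (basis_at A t)) * \prod_j x j 0 (t j)).
Proof.
move=> hT; set S := fun x : {ffun I -> 'rV[F]_n} => _.
pose red (h : {ffun I -> 'rV[A]_n}) : {ffun I -> 'rV[F]_n} := [ffun j => map_mx psi (h j)].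
have redD x y : red (x + y) = red x + red y.
  by apply/ffunP => j; rewrite !ffunE map_mxD.
have red_surj y : exists x, red x = y.
  have [lf lfE] := fin_all_exists residue_surj.
  exists [ffun j => map_mx lf (y j)]; apply/ffunP => j; rewrite !ffunE.
  by apply/matrixP => a b; rewrite !mxE lfE.
have E h : chi (w ^+ k.-1 * T h) = residue_char (S (red h)).
  rewrite -residue_charE (mlin_expand hT) rmorph_sum; congr residue_char.
  apply: eq_bigr => t _; rewrite rmorphM rmorph_prod; congr (_ * _).
  by apply: eq_bigr => j _; rewrite ffunE mxE.
rewrite /bias (eq_avg E).
transitivity (avg (fun y => avg (fun h => residue_char (S (red h + y))))).
  rewrite -[LHS](avg_const (0 : {ffun I -> 'rV[F]_n})); apply: eq_avg => y.
  have [x <-] := red_surj y; rewrite -(avg_bij (h := fun h : {ffun I -> 'rV[A]_n} => h + x)).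
    by apply: eq_avg => h; rewrite redD.
  by exists (fun h : {ffun I -> 'rV[A]_n} => h - x) => h; rewrite ?addrK ?subrK.
rewrite avg_exchange (eq_avg (g := fun=> avg (fun x => residue_char (S x)))).
  by rewrite (avg_const (0 : {ffun I -> 'rV[A]_n})).
move=> h; rewrite -[RHS](avg_bij (h := fun y : {ffun I -> 'rV[F]_n} => red h + y)) //.
by exists (fun y => - red h + y) => y; rewrite ?addKr ?addNKr.
Qed.

Lemma bsum_avg (n : nat) (P : {mpoly A[n]}) :
  bsum #|F| l P chi = avg (fun x : 'rV[A]_n => chi (eval P x)).
Proof.
rewrite /bsum /avg mulrC card_mx mul1n card_quotient_ring -expnM mulnC -natrX mulnC.
congr (_ / _); pose f (v : {ffun 'I_n -> A}) : 'rV[A]_n := \row_i v i.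
rewrite [RHS](reindex f) /=.
  by apply: eq_bigr => v _; congr chi; apply: meval_eq => i; rewrite mxE.
apply: onW_bij; exists (fun x : 'rV[A]_n => [ffun i => x 0 i]) => v.
  by apply/ffunP => i; rewrite ffunE mxE.
by apply/rowP => i; rewrite mxE ffunE.
Qed.

End Quotient.

(** * Exponential sums of polynomials of large rank *)

Theorem theorem8p3 :
  forall d s u : nat, (1 <= d)%N -> (1 <= s)%N -> (1 <= u)%N ->
  exists r : nat,
  forall (p : nat) (O : idomainType) (pi : O) (F : finFieldType)
         (l n : nat) (A : finComNzRingType)
         (phi : {rmorphism O -> A}) (psi : {rmorphism A -> F}),
    (* O : ring of integers of a finite extension K/Q_p of degree u,
       pi a uniformizer, p = (pi) its maximal ideal *)
    prime p ->
    is_DVR pi -> pi_complete pi -> char0 O ->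
    (* F = O/p the residue field (via psi \o phi), q = #|F| *)
    (forall y : F, exists x : O, psi (phi x) = y) ->
    (forall x : O, psi (phi x) = 0 <-> rdvd pi x) ->
    (* [K : Q_p] = e f = u with p O = p^e and q = p^f *)
    (exists e f : nat,
        (exists w : O, w \is a GRing.unit /\ p%:R = w * pi ^+ e) /\
        #|F| = (p ^ f)%N /\ (e * f)%N = u) ->
    (* A = A_l = O/p^l, l >= 1 *)
    (1 <= l)%N ->
    (forall y : A, exists x : O, phi x = y) ->
    (forall x : O, phi x = 0 <-> rdvd (pi ^+ l) x) ->
    forall P : {mpoly A[n]},
      msize P = d.+1 ->
      schmidt_rank_ge (Phat psi d P) d r ->
      forall chi : A -> algC,
        add_char chi -> (exists x : A, chi x != 1) ->
        `| bsum #|F| l P chi | < ((#|F|%:R : algC) ^+ (s * dchi chi (phi pi)))^-1.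
Proof.
(* From here on the degree is [d.+1]. *)
case=> // d s u _ _ _.
(* Weyl differencing raises the assumed lower bound to the power [2 ^ d.+1]. *)
have [S HS] := bias_reduction 'I_d.+1 d (s * 2 ^ d.+1).
have [R HR] := rank_le_of_bias 'I_d.+1 d S.
(* A violated bound will produce a Schmidt decomposition with at most [R] terms. *)
exists R.+1 => p O pi F l n A phi psi _ [pi0 _ _] _ _ psi_surj psi_ker _ _ phi_surj phi_ker.
move=> P sP rP chi hchi nchi.
have q1 : (1 < #|F|)%N by apply: finNzRing_gt1.
have qR : (0 : algC) < #|F|%:R by rewrite ltr0n ltnW.
rewrite real_ltNge ?ger0_real ?invr_ge0 ?exprn_ge0 ?(ltW qR) //; apply/negP.
rewrite (bsum_avg pi0 psi_surj psi_ker phi_surj phi_ker) // -exprVn.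
set k := dchi chi (phi pi) => big.
have [k0 kt _] := dchiP pi0 psi_surj psi_ker phi_surj phi_ker hchi nchi.
pose T (h : {ffun 'I_d.+1 -> 'rV[A]_n}) := difs h (eval P) (enum 'I_d.+1) 0.
have mT : mlin [set: 'I_d.+1] T by apply: mlin_difs; apply: deg_le_eval; rewrite sP.
have cT : #|[set: 'I_d.+1]| = d.+1 by rewrite cardsT card_ord.
have bT : #|F|%:R^-1 ^+ (s * 2 ^ d.+1 * k) <= bias chi T.
  apply: le_trans (bias_weyl hchi sP); rewrite mulnAC exprM.
  by apply: lerXn2r => //; rewrite nnegrE ?exprn_ge0 ?invr_ge0 // ltW.
have := HS _ _ _ _ _ _ _ _ q1 cT mT hchi k0 kt bT.
rewrite (bias_residue pi0 psi_surj psi_ker phi_surj phi_ker hchi nchi mT).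
move/(HR _ _ _ _ _ cT (mlin_form _) (residue_char_add pi0 psi_surj psi_ker phi_surj phi_ker hchi nchi)
   (residue_char_nontriv pi0 psi_surj psi_ker phi_surj phi_ker hchi nchi)).
case/(schmidt_of_prank (ltn0Sn d)) => r' r'R.
suff -> : form_mpoly (fun x : {ffun 'I_d.+1 -> 'rV[F]_n} =>
    \sum_t psi (T (basis_at A t)) * \prod_j x j 0 (t j)) = Phat psi d.+1 P.
  by apply: rP.
apply: eq_bigr => t _; rewrite form_basis; congr (psi _ *: _).
by apply/esym/PtildeE => j i; rewrite ffunE mxE eqxx.
Qed.
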